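(* Suppose that $L$ is a positive holomorphic line bundle on a compact complex manifold $X$, with total space $\mathrm{Tot}_L$. Let $\|\cdot\|$ be an arbitrary Hermitian metric on $L$, regarded as a function on $\mathrm{Tot}_L$, and let $\varepsilon$ be an arbitrary positive number. If one puts $$U=\{v\in\mathrm{Tot}_L : \|v\|<\varepsilon\},$$ then all the fibers of the natural submersion $p\colon U\to X$ (the restriction to $U$ of the bundle projection $\mathrm{Tot}_L\to X$) are biholomorphic to the unit disc, but $p$ is not holomorphically locally trivial.
   Context: The unit disc is $D=\{z\in\mathbb{C}: |z|<1\}$. A holomorphic line bundle is positive if it admits a Hermitian metric of positive curvature. A surjective holomorphic submersion $p\colon Y\to X$ of complex manifolds whose fibers are all biholomorphic to the same complex manifold $F$ is called holomorphically locally trivial if for any $x\in X$ there exist a neighborhood $V\ni x$ and a biholomorphism $\varphi\colon p^{-1}(V)\to F\times V$ such that $\mathrm{pr}_V\circ\varphi=p|_{p^{-1}(V)}$, where $\mathrm{pr}_V\colon F\times V\to V$ is the projection. *)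

(* Defs.v *)
From HB Require Import structures.
From mathcomp Require Import all_boot all_order all_algebra.
From mathcomp Require Import complex.
From mathcomp Require Import boolp classical_sets functions cardinality reals.
From mathcomp Require Import topology normedtype derive exp.

Set Implicit Arguments.
Unset Strict Implicit.
Unset Printing Implicit Defensive.

Import Order.TTheory GRing.Theory Num.Theory.
Import numFieldNormedType.Exports.

Local Open Scope classical_set_scope.
Local Open Scope ring_scope.

(** * Complex manifolds *)

(** The model space [E] is a normed space over [R[i]]; the manifolds of dimension
    [n] are those with [E = 'rV[R[i]]_n].  Products of finite-dimensional spaces
    occur as models of product manifolds.  [differentiable] is Frechet
    differentiability over the scalars of the model spaces, which are complex, so
    on an open set it means holomorphic. *)

Record chart (R : realType) (E : normedModType R[i]) (M : topologicalType) := Chart {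
  cdom : set M ;
  cmap : M -> E ;
  cinv : E -> M ;
  cdom_open : open cdom ;
  cimg_open : open (cmap @` cdom) ;
  cmapK : forall x, cdom x -> cinv (cmap x) = x ;
  cmap_cts : forall x, cdom x -> {for x, continuous cmap} ;
  cinv_cts : forall z, (cmap @` cdom) z -> {for z, continuous cinv} }.

Record complexManifold (R : realType) (E : normedModType R[i]) := ComplexManifold {
  carrier :> topologicalType ;
  atlas : set (chart E carrier) ;
  atlas_cover : forall x : carrier, exists2 c, atlas c & cdom c x ;
  atlas_compat : forall c d, atlas c -> atlas d ->
    forall z, (cmap c @` (cdom c `&` cdom d)) z ->
    differentiable (cmap d \o cinv c) z ;
  carrier_hausdorff : hausdorff_space carrier ;
  carrier_second_countable : @second_countable carrier }.

Arguments atlas {R E} _ _.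

Section complex_plane.
Variable R : realType.
Let C : normedModType R[i] := (R[i])^o.

Lemma idchart_img_open : open (@id C @` [set: C]).
Proof. by rewrite image_id; exact: openT. Qed.

Definition idchart : chart C C :=
  @Chart R C C setT id id openT idchart_img_open
    (fun x _ => erefl) (fun x _ => cvg_id) (fun x _ => cvg_id).

Lemma plane_cover (x : C) : exists2 c, [set idchart] c & cdom c x.
Proof. by exists idchart. Qed.

Lemma plane_compat (c d : chart C C) : [set idchart] c -> [set idchart] d ->
  forall z, (cmap c @` (cdom c `&` cdom d)) z ->
  differentiable (cmap d \o cinv c) z.
Proof. by move=> -> -> z _ /=; have [] := is_diff_id z. Qed.

Lemma plane_second_countable : @second_countable C.
Proof.
pose f (q : rat * rat * nat) : set C :=
  ball ((Complex (ratr q.1.1) (ratr q.1.2)) : C) (q.2.+1%:R^-1 : R[i]).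
exists (range f).
  apply: sub_countable; first exact: card_image_le.
  exact: countableP.
split=> [_ [q _ <-]|x V /nbhs_ballP[e /= e0 eV]]; first exact: ball_open.
case: e e0 eV => r s; rewrite ltcE /= => /andP[/eqP -> r0] {s} eV.
have r20 : 0 < r / 2 by rewrite divr_gt0.
have [N] := ltr_add_invr r20.
rewrite add0r => Nr.
have d0 : 0 < (N.+1%:R^-1 / 2 : R) by rewrite divr_gt0 // invr_gt0.
have appr (a : R) : exists q : rat, `|ratr q - a| < N.+1%:R^-1 / 2.
  have [|q] := @rat_in_itvoo R (a - N.+1%:R^-1 / 2) (a + N.+1%:R^-1 / 2).
    by rewrite ltrD2l gtrN.
  rewrite in_itv /= => /andP[q1 q2]; exists q.
  by rewrite ltr_distl q1 q2.
have [q1 hq1] := appr (complex.Re x); have [q2 hq2] := appr (complex.Im x).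
have NC : (N.+1%:R^-1 : R[i]) = (N.+1%:R^-1)%:C%C by rewrite fmorphV rmorph_nat.
have xq : ball ((Complex (ratr q1) (ratr q2)) : C) (N.+1%:R^-1 : R[i]) x.
  rewrite -ball_normE /ball_ /=.
  have -> : (Complex (ratr q1) (ratr q2) - x : R[i]) =
      (ratr q1 - complex.Re x)%:C%C + 'i%C * (ratr q2 - complex.Im x)%:C%C.
    by case: (x) => a b /=; simpc.
  apply: le_lt_trans (ler_normD _ _) _.
  rewrite normrM !normc_def /= !expr0n expr1n add0r !addr0 sqrtr1 mul1r.
  rewrite !sqrtr_sqr -rmorphD NC.
  by rewrite ltcR [ltRHS]splitr ltrD.
exists (f (q1, q2, N)); first by split=> //; exists (q1, q2, N).
move=> y qy; apply: eV.
have -> : (Complex r 0) = (r / 2)%:C%C + (r / 2)%:C%C.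
  by rewrite -rmorphD -splitr.
have NrC : (N.+1%:R^-1 : R[i]) <= (r / 2)%:C%C by rewrite NC lecR ltW.
apply: (@ball_triangle _ _ (Complex (ratr q1) (ratr q2) : C)).
  by apply: ball_sym; exact: le_ball xq.
exact: le_ball qy.
Qed.

Definition plane : complexManifold C :=
  @ComplexManifold R C C [set idchart] plane_cover plane_compat
    (@norm_hausdorff _ C) plane_second_countable.

End complex_plane.

Section product.
Variables (R : realType) (E1 E2 : normedModType R[i]).

Lemma open_setX (T1 T2 : topologicalType) (A : set T1) (B : set T2) :
  open A -> open B -> open (A `*` B).
Proof.
rewrite !openE => oA oB [x y] [/= Ax By]; exists (A, B) => //=.
by split; [exact: oA|exact: oB].
Qed.

Section prodchart.
Variables (M1 M2 : topologicalType) (c : chart E1 M1) (d : chart E2 M2).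

Let pmap (p : M1 * M2) : E1 * E2 := (cmap c p.1, cmap d p.2).
Let pinv (z : E1 * E2) : M1 * M2 := (cinv c z.1, cinv d z.2).
Let pdom : set (M1 * M2) := cdom c `*` cdom d.

Lemma pimgE : pmap @` pdom = (cmap c @` cdom c) `*` (cmap d @` cdom d).
Proof.
apply/seteqP; split=> [_ [[x y] [/= cx dy] <-]|[u v] /= [[x cx <-] [y dy <-]]].
  by split; [exists x|exists y].
by exists (x, y).
Qed.

Lemma pimg_open : open (pmap @` pdom).
Proof. by rewrite pimgE; apply: open_setX; exact: cimg_open. Qed.

Lemma pmapK p : pdom p -> pinv (pmap p) = p.
Proof. by case: p => x y [/= cx dy]; rewrite /pinv /= !cmapK. Qed.

Lemma pmap_cts p : pdom p -> {for p, continuous pmap}.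
Proof.
case=> cx dy; apply: cvg_pair.
  by apply: continuous_comp; [exact: cvg_fst|exact: cmap_cts].
by apply: continuous_comp; [exact: cvg_snd|exact: cmap_cts].
Qed.

Lemma pinv_cts z : (pmap @` pdom) z -> {for z, continuous pinv}.
Proof.
rewrite pimgE => -[cz dz]; apply: cvg_pair.
  by apply: continuous_comp; [exact: cvg_fst|exact: cinv_cts].
by apply: continuous_comp; [exact: cvg_snd|exact: cinv_cts].
Qed.

Definition prodchart : chart (E1 * E2)%type (M1 * M2)%type :=
  @Chart R (E1 * E2)%type (M1 * M2)%type pdom pmap pinv
    (open_setX (cdom_open c) (cdom_open d)) pimg_open pmapK pmap_cts pinv_cts.

End prodchart.

Variables (M1 : complexManifold E1) (M2 : complexManifold E2).

Definition prodatlas : set (chart (E1 * E2)%type (M1 * M2)%type) :=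
  [set prodchart c.1 c.2 | c in atlas M1 `*` atlas M2].

Lemma prodatlas_cover (p : M1 * M2) : exists2 c, prodatlas c & cdom c p.
Proof.
have [c cM cp] := atlas_cover p.1; have [d dM dp] := atlas_cover p.2.
by exists (prodchart c d) => //; exists (c, d).
Qed.

Lemma prodatlas_compat c d : prodatlas c -> prodatlas d ->
  forall z, (cmap c @` (cdom c `&` cdom d)) z ->
  differentiable (cmap d \o cinv c) z.
Proof.
move=> [[c1 c2] /= [c1M c2M] <-] [[d1 d2] /= [d1M d2M] <-] z.
move=> [p [[/= cp1 cp2] [/= dp1 dp2]] <- {z}].
apply: (@differentiable_pair _ _ _ _ ((cmap d1 \o cinv c1) \o fst)
  ((cmap d2 \o cinv c2) \o snd)).
- apply: differentiable_comp; last first.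
    by apply: (atlas_compat c1M d1M); exists p.1.
  by apply: linear_differentiable => x; exact: cvg_fst.
- apply: differentiable_comp; last first.
    by apply: (atlas_compat c2M d2M); exists p.2.
  by apply: linear_differentiable => x; exact: cvg_snd.
Qed.

Lemma prod_hausdorff : hausdorff_space (M1 * M2)%type.
Proof.
move=> [x1 x2] [y1 y2] cl; congr pair.
- apply: (@carrier_hausdorff _ _ M1) => A B xA yB.
  have [[z1 z2] [/= Az Bz]] := cl (fst @^-1` A) (fst @^-1` B)
    (cvg_fst xA) (cvg_fst yB).
  by exists z1.
- apply: (@carrier_hausdorff _ _ M2) => A B xA yB.
  have [[z1 z2] [/= Az Bz]] := cl (snd @^-1` A) (snd @^-1` B)
    (cvg_snd xA) (cvg_snd yB).
  by exists z2.
Qed.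

Lemma prod_second_countable : @second_countable (M1 * M2)%type.
Proof.
have [B1 cB1 [oB1 bB1]] := @carrier_second_countable _ _ M1.
have [B2 cB2 [oB2 bB2]] := @carrier_second_countable _ _ M2.
exists [set A.1 `*` A.2 | A in B1 `*` B2].
  by apply: sub_countable (countableX cB1 cB2); exact: card_image_le.
split=> [_ [[U1 U2] /= [BU1 BU2] <-]|[x y] V [[V1 V2] /= [xV1 yV2] V12]].
  by apply: open_setX; [exact: oB1|exact: oB2].
have [U1 [BU1 xU1] UV1] := bB1 _ _ xV1; have [U2 [BU2 yU2] UV2] := bB2 _ _ yV2.
exists (U1 `*` U2); first by split=> //; exists (U1, U2).
by move=> [u v] [/= /UV1 ? /UV2 ?]; exact: V12.
Qed.

Definition prod_manifold : complexManifold (E1 * E2)%type :=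
  @ComplexManifold R (E1 * E2)%type (M1 * M2)%type prodatlas prodatlas_cover
    prodatlas_compat prod_hausdorff prod_second_countable.

End product.

(** * Holomorphic maps *)

Section holomorphic_maps.
Variables (R : realType) (E1 E2 : normedModType R[i]).
Variables (M : complexManifold E1) (N : complexManifold E2).

Definition holomorphic_at (f : M -> N) (x : M) : Prop :=
  {for x, continuous f} /\
  forall c d, atlas M c -> atlas N d -> cdom c x -> cdom d (f x) ->
    differentiable (cmap d \o f \o cinv c) (cmap c x).

(** Maps are total functions, of which only the values on [A] matter.  If [A] is
    open this is holomorphy at every point of [A]; if [A] is a complex submanifold,
    e.g. a fibre of a submersion, a map is holomorphic for the induced complex
    structure iff it extends holomorphically to the ambient manifold around each
    point of [A]. *)
Definition holomorphic_on (A : set M) (f : M -> N) : Prop :=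
  forall x, A x -> exists (W : set M) (g : M -> N),
    [/\ open W, W x, forall y, W y -> holomorphic_at g y
      & forall y, A y -> W y -> g y = f y].

Definition submersive_at (f : M -> N) (x : M) : Prop :=
  forall c d, atlas M c -> atlas N d -> cdom c x -> cdom d (f x) ->
    forall w, exists v, 'd (cmap d \o f \o cinv c) (cmap c x) v = w.

End holomorphic_maps.

Definition biholomorphism (R : realType) (E1 E2 : normedModType R[i])
    (M : complexManifold E1) (N : complexManifold E2)
    (f : M -> N) (g : N -> M) (A : set M) (B : set N) : Prop :=
  [/\ holomorphic_on A f, holomorphic_on B g, f @` A `<=` B, g @` B `<=` A
    & (forall x, A x -> g (f x) = x) /\ (forall y, B y -> f (g y) = y)].

Definition biholomorphic (R : realType) (E1 E2 : normedModType R[i])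
    (M : complexManifold E1) (N : complexManifold E2)
    (A : set M) (B : set N) : Prop :=
  exists (f : M -> N) (g : N -> M), biholomorphism f g A B.

Definition unit_disc (R : realType) : set (plane R) :=
  [set z : (R[i])^o | `|z| < 1].
Arguments unit_disc : clear implicits.

Section submersions.
Variables (R : realType) (E1 E2 : normedModType R[i]).
Variables (M : complexManifold E1) (X : complexManifold E2).
Variables (Y : set M) (p : M -> X).

(** In this section the source of the submersion is the open submanifold [Y] of
    [M], and [p] is considered on [Y] only. *)

Definition holomorphic_submersion : Prop :=
  [/\ open Y, holomorphic_on Y p & forall y, Y y -> submersive_at p y].

Definition submersion_fiber (x : X) : set M := Y `&` p @^-1` [set x].

Definition holomorphically_locally_trivial : Prop :=
  exists (k : nat) (F : complexManifold 'rV[R[i]]_k),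
    (forall x, biholomorphic (submersion_fiber x) [set: F]) /\
    forall x, exists (V : set X) (phi : M -> prod_manifold F X)
        (psi : prod_manifold F X -> M),
      [/\ open V, V x,
          biholomorphism phi psi (Y `&` p @^-1` V) ([set: F] `*` V)
        & forall y, Y y -> V (p y) -> (phi y).2 = p y].

End submersions.

(** * Line bundles and Hermitian metrics *)

(** [tot] is the total space, whose points over [x] are the [incl u] for
    [u : fiber x].  The fibres have dimension one by [loc_triv]. *)
Record line_bundle (R : realType) (n : nat) (X : complexManifold 'rV[R[i]]_n) :=
  LineBundle {
  fiber : X -> lmodType R[i] ;
  tot : complexManifold 'rV[R[i]]_n.+1 ;
  proj : tot -> X ;
  incl : forall x, fiber x -> tot ;
  vec : forall v : tot, fiber (proj v) ;
  proj_incl : forall x (u : fiber x), proj (incl u) = x ;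
  incl_inj : forall x, injective (@incl x) ;
  vecK : forall v : tot, incl (vec v) = v ;
  loc_triv : forall x, exists (V : set X) (t : tot -> prod_manifold X (plane R))
      (s : prod_manifold X (plane R) -> tot),
    [/\ open V, V x, biholomorphism t s (proj @^-1` V) (V `*` [set: plane R]),
        forall v, V (proj v) -> (t v).1 = proj v
      & forall y, V y ->
          linear (fun u : fiber y => (t (incl u)).2 : (R[i])^o)] }.

Arguments fiber {R n X} _ _.
Arguments tot {R n X} _.
Arguments proj {R n X} _ _.
Arguments incl {R n X} _ {x} _.
Arguments vec {R n X} _ _.

(** [s] is a section of the bundle; its values outside [V] are irrelevant. *)
Definition local_frame (R : realType) (n : nat) (X : complexManifold 'rV[R[i]]_n)
    (L : line_bundle X) (V : set X) (s : forall x, fiber L x) : Prop :=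
  [/\ open V, holomorphic_on V (fun x => incl L (s x) : tot L)
    & forall x, V x -> s x != 0].

Section real_calculus.
Variables (R : realType) (E : normedModType R[i]).

(** Derivative along the real line spanned by [v]. *)
Definition real_derive (v : E) (u : E -> R) (z : E) : R :=
  derive1 (fun t : R => u (z + (t%:C)%C *: v)) 0.

Fixpoint Ck_on (k : nat) (O : set E) (u : E -> R) : Prop :=
  (forall z, O z -> {for z, continuous u}) /\
  if k is k'.+1 then
    forall v, (forall z, O z -> derivable (fun t : R => u (z + (t%:C)%C *: v)) 0 1)
              /\ Ck_on k' O (real_derive v u)
  else True.

Definition smooth_on (M : complexManifold E) (V : set M) (u : M -> R) : Prop :=
  forall c, atlas M c ->
  forall k, Ck_on k (cmap c @` (cdom c `&` V)) (u \o cinv c).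

Definition real_derivec (v : E) (g : E -> R[i]) (z : E) : R[i] :=
  Complex (real_derive v (fun y => complex.Re (g y)) z)
          (real_derive v (fun y => complex.Im (g y)) z).

End real_calculus.

Section wirtinger.
Variables (R : realType) (n : nat).
Implicit Types (j k : 'I_n) (g : 'rV[R[i]]_n -> R[i]) (z : 'rV[R[i]]_n).

(** d/dz_j = (d/dx_j - i d/dy_j) / 2 and its conjugate, where x_j and y_j are the
    real coordinates along e_j and i e_j. *)
Definition dz j g z : R[i] :=
  (real_derivec (delta_mx 0 j) g z
   - 'i%C * real_derivec ('i%C *: delta_mx 0 j) g z) / 2.

Definition dzbar j g z : R[i] :=
  (real_derivec (delta_mx 0 j) g z
   + 'i%C * real_derivec ('i%C *: delta_mx 0 j) g z) / 2.

End wirtinger.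

Record hermitian_metric (R : realType) (n : nat) (X : complexManifold 'rV[R[i]]_n)
    (L : line_bundle X) := HermitianMetric {
  hform : forall x, fiber L x -> fiber L x -> R[i] ;
  hform_linear : forall x (a : R[i]) (u v w : fiber L x),
    hform (a *: u + v) w = a * hform u w + hform v w ;
  hform_conj : forall x (u v : fiber L x), hform v u = (hform u v)^* ;
  hform_pos : forall x (u : fiber L x), u != 0 -> 0 < hform u u ;
  hform_smooth : forall V s, @local_frame R n X L V s ->
    smooth_on V (fun x => complex.Re (hform (s x) (s x))) }.

Section curvature.
Variables (R : realType) (n : nat) (X : complexManifold 'rV[R[i]]_n).
Variables (L : line_bundle X) (h : hermitian_metric L).

Definition sqnorm (x : X) (u : fiber L x) : R := complex.Re (hform h u u).

Definition metric_norm (v : tot L) : R := Num.sqrt (sqnorm (vec L v)).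

(** Components of the Chern curvature form - d dbar log ||s||^2 in the coordinates
    of [c], that is, the form is the sum of [curvature_mx s c x j k] dz_j /\ dzbar_k. *)
Definition curvature_mx (s : forall x, fiber L x)
    (c : chart 'rV[R[i]]_n X) (x : X) : 'M[R[i]]_n :=
  \matrix_(j, k)
    - dz j (dzbar k (fun z => (ln (sqnorm (s (cinv c z))))%:C%C)) (cmap c x).

(** On [R[i]], [0 < z] says that z is real and positive. *)
Definition positive_curvature : Prop :=
  forall (V : set X) (s : forall x, fiber L x) (c : chart 'rV[R[i]]_n X) (x : X),
    local_frame V s -> V x -> atlas X c -> cdom c x ->
    forall w : 'rV[R[i]]_n, w != 0 ->
      0 < \sum_j \sum_k curvature_mx s c x j k * w 0 j * (w 0 k)^*.

End curvature.

Definition positive_line_bundle (R : realType) (n : nat)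
    (X : complexManifold 'rV[R[i]]_n) (L : line_bundle X) : Prop :=
  exists h : hermitian_metric L, positive_curvature h.

(* Main.v *)
Require Import Defs.
From HB Require Import structures.
From mathcomp Require Import all_boot all_order all_algebra.
From mathcomp Require Import complex ring lra.
From mathcomp Require Import boolp classical_sets functions reals.
From mathcomp Require Import topology normedtype landau derive exp.
From mathcomp Require realfun.

Set Implicit Arguments.
Unset Strict Implicit.
Unset Printing Implicit Defensive.

Import Order.TTheory GRing.Theory Num.Theory.
Import numFieldNormedType.Exports.

Local Open Scope classical_set_scope.
Local Open Scope ring_scope.

(** Suppose that the disc bundle U is locally trivial, and let h0 be a metric of
    positive curvature.  Since X is compact, the ratio h0 / h attains its minimum
    at some x0 ([metric_ratio_min]).  A trivialization of U near x0 retracts U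
    onto the fibre over x0, by a holomorphic map which is the identity on that
    fibre ([local_retraction]).  Read in a trivialization of L, it is a function
    f (x, w) which sends the disc |w| < eps / R x into the disc of radius
    eps / R x0, where R x is the h-norm of the frame e x, and f (x0, w) = w.

    Let G x be the derivative of f (x, _) at 0.  It is holomorphic in x, the
    Cauchy estimate gives |G x| <= R x / R x0, and G x0 = 1.  So the frame
    e / G has h-norm at least R x0, with equality at x0.  Multiplying by h0 / h,
    which is minimal at x0, the h0-norm of e / G has a local minimum at x0.  There
    the second derivatives of its logarithm along all real directions are
    nonnegative, so the diagonal entries of the curvature of h0 are nonpositive
    ([curvature_at_minimum]), against positivity.

    Maps are only assumed to be complex differentiable at each point, so
    the proof rests on three facts of complex analysis:
    the Cauchy estimate with its sharp constant ([cauchy_estimate]), the fact that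
    a directional derivative of a differentiable function is again differentiable
    ([derive_differentiable]), and local estimates of second order
    ([second_difference], [quadratic_remainder]).  All follow from the Schwarz
    lemma ([schwarz]).  That one is proved without integrals: the bisection
    argument of Goursat is applied to trapezoidal sums ([goursat]) and gives a
    bound of |f 0| by twice the maximum of |f| on an annulus; taking powers of f
    removes the factor 2 ([annulus_bound]), a perturbation turns the annulus into
    a circle ([max_principle]), and powers again give the Schwarz lemma.

    The trivializations in the definition of a line bundle live on preimages of
    open sets under the projection, whose continuity is not part of the
    definition.  That these preimages are open is a consequence of the equality of
    dimensions ([biholomorphism_open]); it makes U open, the projection
    holomorphic and the fibres of U discs. *)

(** * Real-valued norms on complex normed spaces *)

Section rnorm.
Variable R : realType.

(** Norms over [R[i]] take values in [R[i]], where the order is partial; their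
    real parts allow estimates over the ordered field [R]. *)
Definition rnorm (E : normedZmodType R[i]) (x : E) : R := complex.Re `|x|.

Lemma rnormE (E : normedZmodType R[i]) (x : E) : `|x| = (rnorm x)%:C%C.
Proof.
by rewrite /rnorm RRe_real ?normr_real.
Qed.

Section zmod.
Variable E : normedZmodType R[i].
Implicit Types x y : E.

Lemma rnorm_ge0 x : 0 <= rnorm x.
Proof. by rewrite -lecR -rnormE; exact: normr_ge0. Qed.

Lemma rnormD x y : rnorm (x + y) <= rnorm x + rnorm y.
Proof. by rewrite -lecR rmorphD /= -!rnormE ler_normD. Qed.

Lemma rnormN x : rnorm (- x) = rnorm x.
Proof. by rewrite /rnorm normrN. Qed.

Lemma rnormB x y : rnorm (x - y) <= rnorm x + rnorm y.
Proof. by rewrite -(rnormN y) rnormD. Qed.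

Lemma rnormC x y : rnorm (x - y) = rnorm (y - x).
Proof. by rewrite /rnorm distrC. Qed.

Lemma rnorm0 : rnorm (0 : E) = 0.
Proof. by rewrite /rnorm normr0. Qed.

Lemma rnorm_eq0 x : (rnorm x == 0) = (x == 0).
Proof. by rewrite -(inj_eq (@complexI R)) -rnormE normr_eq0. Qed.

Lemma rnorm_gt0 x : (0 < rnorm x) = (x != 0).
Proof. by rewrite lt_neqAle rnorm_ge0 andbT eq_sym rnorm_eq0. Qed.

End zmod.

Lemma rnormZ (E : normedModType R[i]) (a : R[i]) (x : E) :
  rnorm (a *: x) = rnorm a * rnorm x.
Proof. by apply: complexI; rewrite rmorphM /= -!rnormE normrZ. Qed.

Implicit Types z w : R[i].

Lemma rnormM z w : rnorm (z * w) = rnorm z * rnorm w.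
Proof. by apply: complexI; rewrite rmorphM /= -!rnormE normrM. Qed.

Lemma rnorm1 : rnorm (1 : R[i]) = 1.
Proof. by rewrite /rnorm normr1. Qed.

Lemma rnormX z n : rnorm (z ^+ n) = rnorm z ^+ n.
Proof. by apply: complexI; rewrite rmorphXn /= -!rnormE normrX. Qed.

Lemma rnormV z : rnorm z^-1 = (rnorm z)^-1.
Proof. by apply: complexI; rewrite fmorphV /= -!rnormE normfV. Qed.

Lemma rnorm_real (a : R) : rnorm a%:C%C = `|a|.
Proof. by rewrite /rnorm normc_def /= expr0n addr0 sqrtr_sqr. Qed.

Lemma rnorm_i : rnorm ('i%C : R[i]) = 1.
Proof. by rewrite /rnorm normc_def /= expr0n expr1n add0r sqrtr1. Qed.

Lemma rnorm_Re z : `|complex.Re z| <= rnorm z.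
Proof. by rewrite -lecR -rnormE normc_ge_Re. Qed.

Lemma rnorm_Im z : `|complex.Im z| <= rnorm z.
Proof. by rewrite /rnorm normc_def /= -sqrtr_sqr ler_wsqrtr // lerDr sqr_ge0. Qed.

Lemma rnorm_le z : rnorm z <= `|complex.Re z| + `|complex.Im z|.
Proof.
case: z => a b /=; have -> : (Complex a b) = a%:C%C + 'i%C * b%:C%C by simpc.
by apply: le_trans (rnormD _ _) _; rewrite rnormM rnorm_i mul1r !rnorm_real.
Qed.

Lemma rnorm_sqr z : rnorm z ^+ 2 = complex.Re z ^+ 2 + complex.Im z ^+ 2.
Proof. by rewrite /rnorm normc_def /= sqr_sqrtr // addr_ge0 ?sqr_ge0. Qed.

Lemma pos_complexE (e : R[i]) : 0 < e -> exists2 d : R, 0 < d & e = d%:C%C.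
Proof.
case: e => a b; rewrite ltcE /= => /andP[/eqP -> a0].
by exists a.
Qed.

Section nbhs_rnorm.
Variable E : normedModType R[i].

Lemma nbhs_rnormP (x : E) (P : set E) :
  nbhs x P <-> exists2 d : R, 0 < d & forall y, rnorm (y - x) < d -> P y.
Proof.
split=> [/nbhs_ballP[e /= /pos_complexE[d d0 ->] eP]|[d d0 dP]].
  exists d => // y yx; apply: eP.
  by rewrite -ball_normE /ball_ /= distrC rnormE ltcR.
apply/nbhs_ballP; exists d%:C%C; first by rewrite /= ltcR.
move=> y; rewrite -ball_normE /ball_ /= distrC rnormE ltcR; exact: dP.
Qed.

End nbhs_rnorm.

Section differentiable_rnorm.
Variable E : normedModType R[i].

Lemma differentiable_rnorm (F : normedModType R[i]) (f : E -> F) x :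
  differentiable f x -> forall e : R, 0 < e -> exists2 d : R, 0 < d &
    forall y, rnorm (y - x) < d ->
      rnorm (f y - f x - 'd f x (y - x)) <= e * rnorm (y - x).
Proof.
move=> /diff_locallyP[_ /eqaddoP fx] e e0.
have /fx : 0 < e%:C%C :> R[i] by rewrite ltcR.
move=> /nbhs_rnormP[d d0 dP]; exists d => // y yx.
have := dP (y - x); rewrite subr0 => /(_ yx).
rewrite !fctE /= subrK !rnormE -rmorphM lecR /= => H.
by rewrite -addrA -opprD.
Qed.

Lemma continuous_rnormP (F : normedModType R[i]) (f : E -> F) x :
  {for x, continuous f} <-> forall e : R, 0 < e -> exists2 d : R, 0 < d &
    forall y, rnorm (y - x) < d -> rnorm (f y - f x) < e.
Proof.
split=> [cf e e0|cf P /nbhs_rnormP[e e0 eP]].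
  have /cf/nbhs_rnormP[d d0 dP] : nbhs (f x) [set z | rnorm (z - f x) < e].
    by apply/nbhs_rnormP; exists e.
  by exists d.
have [d d0 dP] := cf e e0.
by apply/nbhs_rnormP; exists d => // y /dP /eP.
Qed.

Lemma rnorm_differentiable (F : normedModType R[i]) (f : E -> F) (x : E)
    (A : {linear E -> F}) (K : R) :
  (forall k, rnorm (A k) <= K * rnorm k) ->
  (forall e : R, 0 < e -> exists2 d : R, 0 < d &
    forall k, rnorm k < d -> rnorm (f (x + k) - f x - A k) <= e * rnorm k) ->
  differentiable f x /\ 'd f x = A :> (E -> F).
Proof.
move=> AK fx.
have Ac : continuous A.
  move=> z; apply/continuous_rnormP => e e0; exists (e / (`|K| + 1)) => [|y yz].
    by rewrite divr_gt0 // ltr_wpDl.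
  rewrite -linearB; apply: le_lt_trans (AK _) _.
  apply: (@le_lt_trans _ _ ((`|K| + 1) * rnorm (y - z))).
    rewrite ler_wpM2r ?rnorm_ge0 //; apply: le_trans (ler_norm _) _.
    by rewrite lerDl.
  by rewrite mulrC -ltr_pdivlMr // ltr_wpDl.
have fA : f \o shift x = cst (f x) + A +o_ 0 id.
  apply/eqaddoP => e /pos_complexE[d d0 ->].
  have [r r0 rP] := fx d d0.
  apply/nbhs_rnormP; exists r => // y; rewrite subr0 => /rP.
  by rewrite !fctE /= !rnormE -rmorphM lecR /= opprD addrA (addrC x).
have dA := diff_unique Ac fA; split=> //.
by apply/diff_locallyP; rewrite dA.
Qed.

End differentiable_rnorm.
End rnorm.

(** * Goursat's lemma for trapezoidal sums *)

Section completeness.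
Variable R : realType.

(** The sequences [u j - 2 K / 2 ^ j] and [u j + 2 K / 2 ^ j] are monotone and
    bracket the limit. *)
Lemma geometric_cvg_real (u : nat -> R) (K : R) :
  (forall j, `|u j.+1 - u j| <= K / 2 ^+ j) ->
  exists l, forall j, `|u j - l| <= 2 * K / 2 ^+ j.
Proof.
move=> uK.
pose v j := u j - 2 * K / 2 ^+ j; pose w j := u j + 2 * K / 2 ^+ j.
have K0 : 0 <= K by have := le_trans (normr_ge0 _) (uK 0); rewrite expr0 divr1.
have p2 j : 0 < 2 ^- j :> R by rewrite invr_gt0 exprn_gt0.
have pS j : 2 ^- j.+1 = 2 ^- j / 2 :> R by rewrite exprS invfM mulrC.
have vS j : v j <= v j.+1.
  have := uK j; rewrite ler_norml /v pS => /andP[+ _]; have := p2 j; nra.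
have wS j : w j.+1 <= w j.
  have := uK j; rewrite ler_norml /w pS => /andP[_]; have := p2 j; nra.
have vw j : v j <= w j by rewrite /v /w; have := p2 j; nra.
have vi i j : (i <= j)%N -> v i <= v j.
  by move=> /subnK <-; elim: (j - i)%N => // k IH; exact: le_trans IH (vS _).
have wi i j : (i <= j)%N -> w j <= w i.
  by move=> /subnK <-; elim: (j - i)%N => // k IH; exact: le_trans (wS _) IH.
have vwij i j : v i <= w j.
  have [ij|/ltnW ji] := leqP i j; first exact: le_trans (vi _ _ ij) (vw j).
  exact: le_trans (vw i) (wi _ _ ji).
have hs : has_sup (range v).
  by split; [exists (v 0); exists 0 | exists (w 0) => _ [i _ <-]].
exists (sup (range v)) => j.
rewrite ler_distlC -/(v j) -/(w j); apply/andP; split.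
  by apply: (sup_upper_bound hs); exists j.
by apply: ge_sup; [exists (v 0); exists 0 | move=> _ [i _ <-]].
Qed.

Lemma half_pow_small (K d : R) : 0 < d -> exists n, K / 2 ^+ n < d.
Proof.
move=> d0; have := archi_boundP (normr_ge0 (K / d)).
set n := Num.bound _ => nK; exists n.
rewrite ltr_pdivrMr ?exprn_gt0 // mulrC -ltr_pdivrMr //.
apply: le_lt_trans (ler_norm _) _; apply: lt_trans nK _.
by rewrite -natrX ltr_nat ltn_expl.
Qed.

Lemma geometric_cvg (u : nat -> R[i]) (K : R) :
  (forall j, rnorm (u j.+1 - u j) <= K / 2 ^+ j) ->
  exists l, forall j, rnorm (u j - l) <= 4 * K / 2 ^+ j.
Proof.
move=> uK.
have [|l1 h1] := @geometric_cvg_real (fun j => complex.Re (u j)) K.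
  by move=> j; apply: le_trans (uK j); rewrite -raddfB rnorm_Re.
have [|l2 h2] := @geometric_cvg_real (fun j => complex.Im (u j)) K.
  by move=> j; apply: le_trans (uK j); rewrite -raddfB rnorm_Im.
exists (Complex l1 l2) => j; apply: le_trans (rnorm_le _) _.
have -> : 4 * K / 2 ^+ j = 2 * K / 2 ^+ j + 2 * K / 2 ^+ j by lra.
apply: lerD; [have := h1 j|have := h2 j]; by case: (u j).
Qed.

End completeness.

Section trapezoid.
Variable R : realType.
Implicit Types (f g : R[i] -> R[i]) (a b c z : R[i]) (K : set R[i]) (N : nat).

Local Notation C := (R[i])^o.
Local Notation cdiff f p := (differentiable (f : C -> C) (p : C)).
Local Notation cD f p := ('d (f : C -> C) (p : C)).

(** Trapezoidal sums over the segment from [a] to [b], cut into [2 ^ N] equal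
    pieces; they replace line integrals.  Recursion on the midpoint makes the
    subdivision of a segment a conversion. *)
Fixpoint trapz N f a b : R[i] :=
  if N is N'.+1 then trapz N' f a ((a + b) / 2) + trapz N' f ((a + b) / 2) b
  else (f a + f b) / 2 * (b - a).

(** The part of convexity which keeps all sample points of [trapz] in [K]. *)
Definition midclosed K := forall a b, K a -> K b -> K ((a + b) / 2).

Lemma trapz_rev N f a b : trapz N f b a = - trapz N f a b.
Proof.
elim: N a b => [|N IH] a b /=; first ring.
by rewrite opprD -!IH addrC (addrC b a).
Qed.

Lemma trapz_eq K N f g a b : midclosed K -> (forall z, K z -> f z = g z) ->
  K a -> K b -> trapz N f a b = trapz N g a b.
Proof.
move=> mK fg; elim: N a b => [|N IH] a b Ka Kb /=; first by rewrite !fg.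
by rewrite !IH //; apply: mK.
Qed.

Lemma trapzB N f g a b :
  trapz N (fun z => f z - g z) a b = trapz N f a b - trapz N g a b.
Proof. by elim: N a b => [|N IH] a b /=; rewrite ?IH; ring. Qed.

Lemma trapzZ N f a b k : trapz N (fun z => k * f z) a b = k * trapz N f a b.
Proof. by elim: N a b => [|N IH] a b /=; rewrite ?IH; ring. Qed.

Lemma trapz_scale N f a b k :
  trapz N (fun z => k * f (k * z)) a b = trapz N f (k * a) (k * b).
Proof.
elim: N a b => [|N IH] a b /=; first ring.
by rewrite !IH; congr (trapz _ _ _ _ + trapz _ _ _ _); ring.
Qed.

Lemma trapz_affine N A B p a b :
  trapz N (fun z => A + B * (z - p)) a b =
  (A + B * (a - p) + (A + B * (b - p))) / 2 * (b - a).
Proof. by elim: N a b => [//|N IH] a b /=; rewrite !IH; field. Qed.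

Lemma rnorm2 : rnorm (2 : R[i]) = 2.
Proof. by rewrite -(rmorph_nat (real_complex R)) rnorm_real ger0_norm. Qed.

Lemma trapz_bound K N f a b (M : R) : midclosed K ->
  (forall z, K z -> rnorm (f z) <= M) -> K a -> K b ->
  rnorm (trapz N f a b) <= M * rnorm (b - a).
Proof.
move=> mK fM; elim: N a b => [|N IH] a b Ka Kb /=.
  rewrite rnormM ler_wpM2r ?rnorm_ge0 // rnormM rnormV rnorm2 ler_pdivrMr //.
  apply: le_trans (rnormD _ _) _; have := fM _ Ka; have := fM _ Kb; lra.
apply: le_trans (rnormD _ _) _.
have Km : K ((a + b) / 2) by exact: mK.
have := IH _ _ Ka Km; have := IH _ _ Km Kb.
have -> : (a + b) / 2 - a = (b - a) / 2 by field.
have -> : b - (a + b) / 2 = (b - a) / 2 by field.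
rewrite [rnorm ((b - a) / 2)]rnormM rnormV rnorm2; lra.
Qed.

Definition tri N f a b c := trapz N f a b + trapz N f b c + trapz N f c a.

Definition perim a b c : R := rnorm (b - a) + rnorm (c - b) + rnorm (a - c).

(** The sums over the three inner edges cancel, as each edge is run through twice,
    in opposite directions. *)
Lemma tri_split N f a b c :
  let p := (a + b) / 2 in let q := (b + c) / 2 in let r := (c + a) / 2 in
  tri N.+1 f a b c =
    tri N f a p r + tri N f p b q + tri N f r q c + tri N f p q r.
Proof.
move=> p q r; rewrite /tri /= -/p -/q -/r.
rewrite (trapz_rev N f q p) (trapz_rev N f r q) (trapz_rev N f p r); ring.
Qed.

Lemma perim_split a b c :
  let p := (a + b) / 2 in let q := (b + c) / 2 in let r := (c + a) / 2 in
  [/\ perim a p r = perim a b c / 2, perim p b q = perim a b c / 2,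
      perim r q c = perim a b c / 2 & perim p q r = perim a b c / 2].
Proof.
have e (x y : R[i]) : x = y / 2 -> rnorm x = rnorm y / 2.
  by move=> ->; rewrite rnormM rnormV rnorm2.
move=> p q r; rewrite /perim.
have e1 : rnorm (p - a) = rnorm (b - a) / 2 by apply: e; rewrite /p; field.
have e2 : rnorm (b - p) = rnorm (b - a) / 2 by apply: e; rewrite /p; field.
have e3 : rnorm (q - r) = rnorm (b - a) / 2 by apply: e; rewrite /q /r; field.
have e4 : rnorm (q - b) = rnorm (c - b) / 2 by apply: e; rewrite /q; field.
have e5 : rnorm (c - q) = rnorm (c - b) / 2 by apply: e; rewrite /q; field.
have e6 : rnorm (r - p) = rnorm (c - b) / 2 by apply: e; rewrite /r /p; field.
have e7 : rnorm (r - c) = rnorm (a - c) / 2 by apply: e; rewrite /r; field.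
have e8 : rnorm (a - r) = rnorm (a - c) / 2 by apply: e; rewrite /r; field.
have e9 : rnorm (p - q) = rnorm (a - c) / 2 by apply: e; rewrite /p /q; field.
rewrite (rnormC r q) (rnormC q p) (rnormC p r) e1 e2 e3 e4 e5 e6 e7 e8 e9.
by split; lra.
Qed.

Lemma perim_ge0 a b c : 0 <= perim a b c.
Proof. by rewrite /perim !addr_ge0 ?rnorm_ge0. Qed.

Lemma tri_bound K N f a b c (M : R) : midclosed K ->
  (forall z, K z -> rnorm (f z) <= M) -> K a -> K b -> K c ->
  rnorm (tri N f a b c) <= M * perim a b c.
Proof.
move=> mK fM Ka Kb Kc; rewrite /tri /perim.
apply: le_trans (rnormD _ _) _; rewrite mulrDr; apply: lerD.
  by apply: le_trans (rnormD _ _) _; rewrite mulrDr; apply: lerD;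
    exact: (trapz_bound _ mK).
exact: (trapz_bound _ mK).
Qed.

Lemma triB N f g a b c :
  tri N (fun z => f z - g z) a b c = tri N f a b c - tri N g a b c.
Proof. by rewrite /tri !trapzB; ring. Qed.

Lemma tri_affine N A B p a b c : tri N (fun z => A + B * (z - p)) a b c = 0.
Proof. by rewrite /tri !trapz_affine; field. Qed.

Lemma midclosed_ball (p : R[i]) (r : R) : midclosed [set z | rnorm (z - p) <= r].
Proof.
move=> a b /= ha hb; have -> : (a + b) / 2 - p = (a - p + (b - p)) / 2 by field.
rewrite rnormM rnormV rnorm2; have := rnormD (a - p) (b - p); lra.
Qed.

Lemma linear_mul1 (A : {linear C -> C}) (h : C) : A h = A 1 * h.
Proof.
have {1}-> : h = h *: (1 : C) by rewrite /GRing.scale /= mulr1.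
by rewrite linearZ mulrC.
Qed.

(** The sums of the affine approximation of [f] at [p] vanish, so only the error
    of the approximation contributes. *)
Lemma tri_diff f (p : R[i]) (e r : R) a b c N :
  (forall z, rnorm (z - p) <= r ->
     rnorm (f z - f p - cD f p (z - p)) <= e) ->
  rnorm (a - p) <= r -> rnorm (b - p) <= r -> rnorm (c - p) <= r ->
  rnorm (tri N f a b c) <= e * perim a b c.
Proof.
move=> fe ap bp cp.
set B := cD f p 1.
have -> : tri N f a b c = tri N (fun z => f z - (f p + B * (z - p))) a b c.
  by rewrite triB tri_affine subr0.
apply: (tri_bound _ (@midclosed_ball p r)) => // z /fe.
have -> : cD f p (z - p) = B * (z - p).
  exact: linear_mul1.
by rewrite opprD addrA.
Qed.

(** The bound in [good] scales like the area.  It therefore passes from the four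
    quarters of a triangle to the triangle, and a bad triangle has a bad quarter.
    The bad triangles obtained by iteration shrink to a point, near which the
    affine approximation makes small triangles good. *)
Section goursat.
Variables (K : set R[i]) (f : R[i] -> R[i]) (e : R).
Hypothesis mK : midclosed K.
Hypothesis df : forall p, closure (K : set C) p ->
  cdiff f p.
Hypothesis e0 : 0 < e.

Let good a b c := exists N0, forall N, (N0 <= N)%N ->
  rnorm (tri N f a b c) <= e * perim a b c ^+ 2.

Let good_split a b c :
  let p := (a + b) / 2 in let q := (b + c) / 2 in let r := (c + a) / 2 in
  good a p r -> good p b q -> good r q c -> good p q r -> good a b c.
Proof.
move=> p q r [N1 h1] [N2 h2] [N3 h3] [N4 h4].
exists (maxn (maxn N1 N2) (maxn N3 N4)).+1 => -[//|N].
rewrite ltnS !geq_max => /andP[/andP[n1 n2] /andP[n3 n4]].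
rewrite tri_split -/p -/q -/r.
have [P1 P2 P3 P4] := perim_split a b c.
have := h1 _ n1; have := h2 _ n2; have := h3 _ n3; have := h4 _ n4.
rewrite P1 P2 P3 P4.
set A := tri _ _ _ _ _; set B := tri _ _ _ _ _.
set C := tri _ _ _ _ _; set D := tri _ _ _ _ _ => hA hB hC hD.
have := rnormD (D + C + B) A; have := rnormD (D + C) B; have := rnormD D C.
rewrite expr_div_n in hA hB hC hD; lra.
Qed.

Lemma goursat_aux a b c : K a -> K b -> K c -> good a b c.
Proof.
move=> Ka Kb Kc; apply: contrapT => bad0.
pose T := {t : R[i] * R[i] * R[i] |
  [/\ K t.1.1, K t.1.2, K t.2 & ~ good t.1.1 t.1.2 t.2]}.
pose pe (t : T) := perim (sval t).1.1 (sval t).1.2 (sval t).2.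
pose rel (t t' : T) := pe t' = pe t / 2 /\
  rnorm ((sval t').1.1 - (sval t).1.1) <= pe t.
have step (t : T) : {t' : T | rel t t'}.
  apply: cid; case: t => [[[x y] z] [/= Kx Ky Kz bad]].
  set p := (x + y) / 2; set q := (y + z) / 2; set r := (z + x) / 2.
  have [Kp Kq Kr] : [/\ K p, K q & K r] by split; exact: mK.
  have [P1 P2 P3 P4] := perim_split x y z.
  have [px rx] : rnorm (p - x) <= perim x y z /\ rnorm (r - x) <= perim x y z.
    have := perim_ge0 x y z; rewrite /perim.
    have := rnorm_ge0 (y - x); have := rnorm_ge0 (x - z); have := rnorm_ge0 (z - y).
    have -> : p - x = (y - x) / 2 by rewrite /p; field.
    have -> : r - x = - ((x - z) / 2) by rewrite /r; field.
    rewrite rnormN !rnormM rnormV rnorm2; split; lra.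
  have xx : rnorm (x - x) <= perim x y z by rewrite subrr rnorm0 perim_ge0.
  rewrite /rel /pe /=.
  have [g1|b1] := pselect (good x p r); last first.
    by exists (exist _ (x, p, r) (And4 Kx Kp Kr b1)).
  have [g2|b2] := pselect (good p y q); last first.
    by exists (exist _ (p, y, q) (And4 Kp Ky Kq b2)).
  have [g3|b3] := pselect (good r q z); last first.
    by exists (exist _ (r, q, z) (And4 Kr Kq Kz b3)).
  have [g4|b4] := pselect (good p q r); last first.
    by exists (exist _ (p, q, r) (And4 Kp Kq Kr b4)).
  by case: bad; exact: good_split.
pose t0 : T := exist _ (a, b, c) (And4 Ka Kb Kc bad0).
pose t := fix t n := if n is n'.+1 then sval (step (t n')) else t0.
have tS n : rel (t n) (t n.+1) by rewrite /=; case: (step (t n)).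
have peE n : pe (t n) = pe t0 / 2 ^+ n.
  elim: n => [|n IH]; first by rewrite expr0 divr1.
  by rewrite (tS n).1 IH exprS invfM mulrA mulrAC.
have [|l hl] := @geometric_cvg R (fun n => (sval (t n)).1.1) (pe t0).
  by move=> n; rewrite -peE; exact: (tS n).2.
have vert n : [/\ rnorm ((sval (t n)).1.1 - l) <= 5 * pe (t n),
    rnorm ((sval (t n)).1.2 - l) <= 5 * pe (t n) &
    rnorm ((sval (t n)).2 - l) <= 5 * pe (t n)].
  have := hl n; rewrite -mulrA -peE /pe /perim.
  case: (sval (t n)) => [[x y] z] /=.
  have := rnorm_ge0 (y - x); have := rnorm_ge0 (x - z); have := rnorm_ge0 (z - y).
  have := rnormD (y - x) (x - l); have := rnormB (x - l) (x - z).
  have -> : y - x + (x - l) = y - l by ring.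
  have -> : x - l - (x - z) = z - l by ring.
  by move=> *; split; lra.
have pe0 := perim_ge0 a b c.
have Kl : closure (K : set C) l.
  move=> B /nbhs_rnormP[d d0 dB].
  have [n hn] := half_pow_small (4 * pe t0) d0.
  exists (sval (t n)).1.1; split; first by case: (svalP (t n)).
  by apply: dB; apply: le_lt_trans (hl n) hn.
have [d d0 hd] := differentiable_rnorm (df Kl) (divr_gt0 e0 (ltr0Sn R 4)).
have [n] := half_pow_small (5 * pe t0) d0; rewrite -mulrA -peE => hn.
case: (svalP (t n)) => _ _ _; apply; exists 0 => N _.
have [v1 v2 v3] := vert n.
rewrite expr2 mulrA; apply: (tri_diff _ _ v1 v2 v3) => z zl.
apply: le_trans (hd _ (le_lt_trans zl hn)) _.
rewrite mulrAC ler_pdivrMr // -mulrA ler_pM2l // mulrC; exact: zl.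
Qed.

End goursat.

Lemma goursat (K : set R[i]) f a b c (e : R) : midclosed K ->
  (forall p, closure (K : set C) p -> cdiff f p) ->
  K a -> K b -> K c -> 0 < e ->
  exists N0, forall N, (N0 <= N)%N -> rnorm (tri N f a b c) <= e.
Proof.
move=> mK df Ka Kb Kc e0; set P := perim a b c ^+ 2 + 1.
have P0 : 0 < P by rewrite ltr_wpDl // sqr_ge0.
have [N0 h] := goursat_aux mK df (divr_gt0 e0 P0) Ka Kb Kc.
exists N0 => N /h /le_trans; apply.
by rewrite mulrAC ler_pdivrMr // ler_pM2l // lerDl.
Qed.

Section vertex.
Variables (q : R[i] -> R[i]) (r B : R).
Hypothesis qB : forall z, rnorm z < r -> rnorm (q z) <= B.
Hypothesis dq : forall z, z != 0 -> rnorm z < r -> cdiff q z.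

(* Positive real parts keep the closure of the triangle away from 0. *)
Let goursat_away b c d : forall e : R, 0 < e ->
  0 < complex.Re b -> 0 < complex.Re c -> 0 < complex.Re d ->
  rnorm b < r -> rnorm c < r -> rnorm d < r ->
  exists N0, forall N, (N0 <= N)%N -> rnorm (tri N q b c d) <= e.
Proof.
move=> e e0 b0 c0 d0 br cr dr.
pose m := Num.min (complex.Re b) (Num.min (complex.Re c) (complex.Re d)).
pose M := Num.max (rnorm b) (Num.max (rnorm c) (rnorm d)).
have m0 : 0 < m by rewrite !lt_min b0 c0.
have Mr : M < r by rewrite !gt_max br cr.
pose K := [set z : R[i] | m <= complex.Re z /\ rnorm z <= M].
have mK : midclosed K.
  move=> x y [/= x1 x2] [y1 y2]; split.
    have -> : complex.Re ((x + y) / 2) = (complex.Re x + complex.Re y) / 2.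
      rewrite -(rmorph_nat (real_complex R)) -fmorphV.
      by case: (x) (y) => ? ? [? ?] /=; rewrite mulr0 subr0.
    lra.
  rewrite rnormM rnormV rnorm2; have := rnormD x y; lra.
apply: (goursat mK _ _ _ _ e0) => [p Kp|||].
- have H (d' : R) : 0 < d' -> exists2 z, K z & rnorm (z - p) < d'.
    move=> d'0; have [|z [Kz zp]] := Kp [set z : C | rnorm (z - p) < d'].
      by apply/nbhs_rnormP; exists d'.
    by exists z.
  apply: dq.
    apply/eqP => p0; have [z [z1 _]] := H _ m0.
    rewrite p0 subr0 => zm; have := rnorm_Re z; have := ler_norm (complex.Re z).
    lra.
  have [z [_ z1] z2] := H (r - M) ltac:(by rewrite subr_gt0).
  by have := rnormB z (z - p); rewrite opprB addrCA subrr addr0; lra.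
- by split; rewrite ?ge_min ?le_max lexx ?orbT.
- by split; rewrite ?ge_min ?le_max lexx ?orbT.
- by split; rewrite ?ge_min ?le_max lexx ?orbT.
Qed.

(** Halving towards the vertex 0 leaves a triangle of half the perimeter at 0 and
    three triangles which avoid 0.  After [m] halvings the part at 0 is at most
    [B * perim / 2 ^ m], since [q] is bounded. *)
Lemma goursat_vertex b c e : 0 < e ->
  0 < complex.Re b -> 0 < complex.Re c -> rnorm b < r -> rnorm c < r ->
  exists N0, forall N, (N0 <= N)%N -> rnorm (tri N q 0 b c) <= e.
Proof.
have half_r z : rnorm z < r -> rnorm (z / 2) < r.
  by rewrite rnormM rnormV rnorm2; have := rnorm_ge0 z; lra.
have half_Re z : 0 < complex.Re z -> 0 < complex.Re (z / 2).
  rewrite -(rmorph_nat (real_complex R)) -fmorphV.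
  by case: z => u v /= u0; rewrite mulr0 subr0 divr_gt0.
have mid_r y z : rnorm y < r -> rnorm z < r -> rnorm ((y + z) / 2) < r.
  by rewrite rnormM rnormV rnorm2; have := rnormD y z; lra.
have mid_Re y z : 0 < complex.Re y -> 0 < complex.Re z -> 0 < complex.Re ((y + z) / 2).
  by move=> y0 z0; apply: half_Re; rewrite raddfD addr_gt0.
suff H m : forall b c e, 0 < e ->
    0 < complex.Re b -> 0 < complex.Re c -> rnorm b < r -> rnorm c < r ->
    exists N0, forall N, (N0 <= N)%N ->
      rnorm (tri N q 0 b c) <= e + B * perim 0 b c / 2 ^+ m.
  move=> e0 b0 c0 br cr.
  have e20 : 0 < e / 2 by rewrite divr_gt0.
  have [m hm] := half_pow_small (B * perim 0 b c) e20.
  have [N0 h] := H m b c _ e20 b0 c0 br cr.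
  by exists N0 => N /h; lra.
elim: m => [|m IH] {}b {}c {}e e0 b0 c0 br cr.
  exists 0 => N _; rewrite expr0 divr1; apply: ler_wpDl; first exact: ltW.
  have mK : midclosed [set z : R[i] | rnorm z < r] by move=> y z; exact: mid_r.
  apply: (tri_bound _ mK) => //=.
  by rewrite rnorm0; exact: le_lt_trans (rnorm_ge0 b) br.
have e40 : 0 < e / 4 by rewrite divr_gt0.
have [N1 h1] := IH (b / 2) (c / 2) _ e40 (half_Re _ b0) (half_Re _ c0)
  (half_r _ br) (half_r _ cr).
have [N2 h2] := goursat_away e40 (half_Re _ b0) b0 (mid_Re _ _ b0 c0)
  (half_r _ br) br (mid_r _ _ br cr).
have [N3 h3] := goursat_away e40 (half_Re _ c0) (mid_Re _ _ b0 c0) c0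
  (half_r _ cr) (mid_r _ _ br cr) cr.
have [N4 h4] := goursat_away e40 (half_Re _ b0) (mid_Re _ _ b0 c0) (half_Re _ c0)
  (half_r _ br) (mid_r _ _ br cr) (half_r _ cr).
exists (maxn (maxn N1 N2) (maxn N3 N4)).+1 => -[//|N].
rewrite ltnS !geq_max => /andP[/andP[n1 n2] /andP[n3 n4]].
rewrite tri_split add0r addr0.
have [P1 _ _ _] := perim_split 0 b c; rewrite add0r addr0 in P1.
have := h1 _ n1; have := h2 _ n2; have := h3 _ n3; have := h4 _ n4; rewrite P1.
set A := tri _ _ _ _ _; set D2 := tri _ _ _ _ _.
set D3 := tri _ _ _ _ _; set D := tri _ _ _ _ _ => hA hB hC hD.
have := rnormD (D + D3 + D2) A; have := rnormD (D + D3) D2; have := rnormD D D3.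
have -> : B * perim 0 b c / 2 ^+ m.+1 = B * (perim 0 b c / 2) / 2 ^+ m.
  by rewrite exprS invfM -!mulrA.
lra.
Qed.

End vertex.

End trapezoid.

(** * Maximum principle and Schwarz lemma *)

Section maxmod.
Variable R : realType.
Local Notation C := (R[i])^o.
Local Notation cdiff f p := (differentiable (f : C -> C) (p : C)).
Local Notation cD f p := ('d (f : C -> C) (p : C)).
Implicit Types (f g : R[i] -> R[i]) (z w : R[i]).

Lemma cdiff_comp f g p : cdiff f p -> cdiff g (f p) -> cdiff (g \o f) p.
Proof. exact: differentiable_comp. Qed.

Lemma cdiff_cst (c : R[i]) p : cdiff (fun=> c) p.
Proof. exact: differentiable_cst. Qed.

Lemma cdiff_id p : cdiff id p.
Proof. by have [] := is_diff_id (p : C). Qed.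

Lemma cdiffD f g p : cdiff f p -> cdiff g p -> cdiff (fun z => f z + g z) p.
Proof. exact: differentiableD. Qed.

Lemma cdiffB f g p : cdiff f p -> cdiff g p -> cdiff (fun z => f z - g z) p.
Proof. exact: differentiableB. Qed.

Lemma cdiffM f g p : cdiff f p -> cdiff g p -> cdiff (fun z => f z * g z) p.
Proof. exact: differentiableM. Qed.

Lemma cdiffV f p : cdiff f p -> f p != 0 -> cdiff (fun z => (f z)^-1) p.
Proof. exact: differentiableV. Qed.

Lemma cdiffX f p n : cdiff f p -> cdiff (fun z => f z ^+ n) p.
Proof.
move=> df; elim: n => [|n IH]; first exact: cdiff_cst.
by under eq_fun do rewrite exprS; exact: cdiffM.
Qed.

Lemma cdiff_affine (b c : R[i]) f p : cdiff f (b + c * p) -> cdiff (fun z => f (b + c * z)) p.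
Proof.
move=> df; apply: (cdiff_comp (f := fun z => b + c * z)) df.
by apply: cdiffD; [exact: cdiff_cst|apply: cdiffM; [exact: cdiff_cst|exact: cdiff_id]].
Qed.

Lemma cdiff_shift b f p : cdiff f (b + p) -> cdiff (fun z => f (b + z)) p.
Proof.
move=> df; apply: (cdiff_comp (f := fun z => b + z)) df.
by apply: cdiffD; [exact: cdiff_cst|exact: cdiff_id].
Qed.

Section annulus.
Variables (f : R[i] -> R[i]) (r B : R).
Hypothesis df : forall z, rnorm z < r -> cdiff f z.
Hypothesis fB : forall z, rnorm z < r -> rnorm (f z) <= B.

Lemma quotient_bounded : 0 < r -> exists B' : R,
  forall z, rnorm z < r -> rnorm ((f z - f 0) / z) <= B'.
Proof.
move=> r0; have d0 : cdiff f 0 by apply: df; rewrite rnorm0.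
have [d dpos hd] := differentiable_rnorm d0 ltr01.
exists (rnorm (cD f 0 1) + 1 + 2 * B / d) => z zr.
have B0 : 0 <= B by exact: le_trans (rnorm_ge0 _) (fB zr).
have Bd : 0 <= 2 * B / d by rewrite divr_ge0 ?mulr_ge0 // ltW.
rewrite rnormM rnormV.
have [->|z0] := eqVneq z 0.
  by rewrite rnorm0 invr0 mulr0 !addr_ge0 ?rnorm_ge0.
have nz : 0 < rnorm z by rewrite rnorm_gt0.
rewrite ler_pdivrMr //.
have [zd|dz] := ltP (rnorm z) d.
  have := hd z; rewrite subr0 mul1r => /(_ zd) h.
  have e : f z - f 0 = (f z - f 0 - cD f 0 z) + cD f 0 1 * z.
    by rewrite -(linear_mul1 (cD f 0) z) subrK.
  rewrite e; apply: le_trans (rnormD _ _) _; rewrite rnormM.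
  have := mulr_ge0 Bd (ltW nz); lra.
apply: (@le_trans _ _ (2 * B)).
  by apply: le_trans (rnormB _ _) _; have := fB zr; have := @fB 0; rewrite rnorm0 => /(_ r0); lra.
apply: (@le_trans _ _ (2 * B / d * rnorm z)).
  by rewrite mulrAC ler_pdivlMr // ler_wpM2l // mulr_ge0.
by rewrite ler_wpM2r ?rnorm_ge0 // lerDr addr_ge0 ?rnorm_ge0.
Qed.

Let q u z := (f (u * z) - f 0) / z.

(** Cauchy's formula on the square with vertices [v], [i v], [- v], [- i v], in
    discrete form.  By rotation, every side is reduced to the side from [v] to
    [i v].  The sums of the difference quotient of [f] at 0 over the four triangles
    with vertex 0 tend to 0, and the edges through 0 cancel.  What remains compares
    [f 0] times the sums [X] of [1 / z] with the sums [Y u] of [f (u z) / z]; here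
    [|X N| >= 1] because the imaginary part of [1 / z * dz] is at least [1 / (2 a)]
    times the length, and [|Y u N| <= 2 M] because the side has length [2 a] and
    [|z| >= a] on it. *)
Lemma annulus_bound_double (a M : R) : 0 < a -> 2 * a < r ->
  (forall z, a <= rnorm z <= 2 * a -> rnorm (f z) <= M) -> rnorm (f 0) <= 2 * M.
Proof.
move=> a0 ar fM.
have r0 : 0 < r by lra.
have [B' hB'] := quotient_bounded r0.
have qE u z : rnorm u = 1 -> q u z = u * q 1 (u * z).
  move=> u1; rewrite /q mul1r.
  have [->|z0] := eqVneq z 0; first by rewrite mulr0 invr0 !mulr0.
  have u0 : u != 0 by rewrite -rnorm_gt0 u1.
  by field; rewrite ?u0 ?z0.
pose v : R[i] := Complex a (- a).
have iv : 'i%C * v = Complex a a by rewrite /v; simpc.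
have vr : rnorm v < r.
  apply: le_lt_trans (rnorm_le _) _; rewrite /v /= normrN (ger0_norm (ltW a0)); lra.
have ivr : rnorm ('i%C * v) < r by rewrite rnormM rnorm_i mul1r.
pose E := [set z : R[i] | complex.Re z = a /\ `|complex.Im z| <= a].
have mE : midclosed E.
  move=> x y [/= x1 x2] [y1 y2].
  rewrite -(rmorph_nat (real_complex R)) -fmorphV.
  case: x y x1 x2 y1 y2 => x x' [y y'] /= -> hx -> hy; split; simpc => /=; first lra.
  by move: hx hy; rewrite !ler_norml; lra.
have Ev : E v by split=> //=; rewrite normrN (ger0_norm (ltW a0)).
have Eiv : E ('i%C * v) by rewrite iv; split=> //=; rewrite (ger0_norm (ltW a0)).
have E_ge z : E z -> a <= rnorm z.
  by move=> [<- _]; exact: le_trans (ler_norm _) (rnorm_Re z).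
have E_le z : E z -> rnorm z <= 2 * a.
  move=> [z1 z2]; apply: le_trans (rnorm_le _) _; rewrite z1 (ger0_norm (ltW a0)); lra.
have E_n0 z : E z -> z != 0.
  by move=> /E_ge az; rewrite -rnorm_gt0; exact: lt_le_trans az.
have nvv : rnorm ('i%C * v - v) = 2 * a.
  have -> : 'i%C * v - v = 'i%C * (2 * a)%:C%C.
    by rewrite iv /v; simpc; rewrite mulr_natl mulr2n.
  by rewrite rnormM rnorm_i mul1r rnorm_real ger0_norm // mulr_ge0 // ltW.
pose X N := trapz N (fun z => z^-1) v ('i%C * v).
have X1 N : 1 <= rnorm (X N).
  apply: le_trans (le_trans (ler_norm _) (rnorm_Im _)).
  have H n x y : E x -> E y -> complex.Im x <= complex.Im y ->
      (complex.Im y - complex.Im x) / (2 * a) <=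
      complex.Im (trapz n (fun z => z^-1) x y).
    elim: n x y => [|n IH] x y Ex Ey xy /=.
      have ix z : E z -> (2 * a)^-1 <= complex.Re z^-1.
        case: z => s t [/= -> ht].
        have st : 0 < a ^+ 2 + t ^+ 2 by rewrite ltr_wpDr ?sqr_ge0 // exprn_gt0.
        rewrite ler_pdivlMr // mulrC ler_pdivrMr ?mulr_gt0 //.
        by move: ht; rewrite ler_norml => /andP[]; nra.
      have -> : y - x = 'i%C * (complex.Im y - complex.Im x)%:C%C.
        by case: x y Ex Ey {xy} => s t [s' t'] [/= -> _] [/= -> _];
          apply/eqP; rewrite eq_complex /=; apply/andP; split; apply/eqP; ring.
      set d := complex.Im y - complex.Im x.
      have -> : complex.Im ((x^-1 + y^-1) / 2 * ('i%C * d%:C%C)) =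
          (complex.Re x^-1 + complex.Re y^-1) / 2 * d.
        rewrite -(rmorph_nat (real_complex R)) -fmorphV.
        by case: (x^-1) (y^-1) => ? ? [? ?] /=; simpc => /=; ring.
      rewrite mulrC ler_wpM2r ?subr_ge0 //.
      by have := ix _ Ex; have := ix _ Ey; lra.
    have Em := mE _ _ Ex Ey.
    have em : complex.Im ((x + y) / 2) = (complex.Im x + complex.Im y) / 2.
      rewrite -(rmorph_nat (real_complex R)) -fmorphV.
      by case: (x) (y) => ? ? [? ?] /=; simpc => /=; ring.
    rewrite raddfD /=.
    have h1 := IH _ _ Ex Em; have h2 := IH _ _ Em Ey; rewrite em in h1 h2.
    have -> : (complex.Im y - complex.Im x) / (2 * a) =
      ((complex.Im x + complex.Im y) / 2 - complex.Im x) / (2 * a) +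
      (complex.Im y - (complex.Im x + complex.Im y) / 2) / (2 * a) by lra.
    by apply: lerD; [apply: h1|apply: h2]; lra.
  have im_iv : complex.Im ('i%C * v) = a by rewrite iv.
  have := H N _ _ Ev Eiv; rewrite im_iv /=; move=> h.
  apply: le_trans (h _); last lra.
  have -> : a - - a = 2 * a by ring.
  by rewrite divff // mulf_neq0 // gt_eqF.
pose Y u N := trapz N (fun z => f (u * z) / z) v ('i%C * v).
have Y1 u N : rnorm u = 1 -> rnorm (Y u N) <= 2 * M.
  move=> u1.
  have -> : 2 * M = M / a * rnorm ('i%C * v - v).
    by rewrite nvv; field; rewrite gt_eqF.
  apply: (trapz_bound _ mE) => // z Ez.
  rewrite rnormM rnormV; apply: ler_pM; rewrite ?invr_ge0 ?rnorm_ge0 //.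
    by apply: fM; rewrite rnormM u1 mul1r E_ge ?E_le.
  by rewrite lef_pV2 ?posrE ?E_ge // rnorm_gt0 E_n0.
have side u e : rnorm u = 1 -> 0 < e -> exists N0, forall N, (N0 <= N)%N ->
    rnorm (trapz N (q 1) 0 (u * v) + (Y u N - f 0 * X N) -
           trapz N (q 1) 0 (u * 'i%C * v)) <= e.
  move=> u1 e0.
  have qr z : rnorm z < r -> rnorm (u * z) < r by rewrite rnormM u1 mul1r.
  have [||||N0 h] := @goursat_vertex R (q u) r B' _ _ v ('i%C * v) e e0 _ _ vr ivr.
  - move=> z zr; rewrite qE // rnormM u1 mul1r /q mul1r; exact: hB' (qr _ zr).
  - move=> z z0 zr; apply: cdiffM; last by apply: cdiffV => //; exact: cdiff_id.
    apply: cdiffB; last exact: cdiff_cst.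
    have := @cdiff_affine 0 u f z; rewrite add0r => /(_ (df (qr _ zr))).
    by under eq_fun do rewrite add0r.
  - by [].
  - by rewrite iv.
  exists N0 => N /h; congr (rnorm _ <= _); rewrite /tri.
  have mT : midclosed [set: R[i]] by [].
  have ext x y : trapz N (q u) x y = trapz N (q 1) (u * x) (u * y).
    by rewrite -trapz_scale; apply: (trapz_eq _ mT) => // z _; exact: qE.
  rewrite (ext 0) (ext _ 0) mulr0 (trapz_rev N (q 1) 0) mulrA; congr (_ + _ - _).
  rewrite /Y /X -trapzZ -trapzB; apply: (trapz_eq _ mE) => // z _.
  by rewrite /q mulrBl.
apply/ler_addgt0Pr => e e0.
have ui : rnorm ('i%C : R[i]) = 1 := rnorm_i R.
have u1 := rnorm1 R.
have [N1 h1] := side _ _ u1 e0.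
have [N2 h2] := side _ _ ui e0.
have [N3 h3] := side (- 1) _ (etrans (rnormN _) u1) e0.
have [N4 h4] := side (- 'i%C) _ (etrans (rnormN _) ui) e0.
pose N := maxn (maxn N1 N2) (maxn N3 N4).
have {}h1 := h1 N ltac:(by rewrite /N !leq_max leqnn ?orbT).
have {}h2 := h2 N ltac:(by rewrite /N !leq_max leqnn ?orbT).
have {}h3 := h3 N ltac:(by rewrite /N !leq_max leqnn ?orbT).
have {}h4 := h4 N ltac:(by rewrite /N !leq_max leqnn ?orbT).
have ii : 'i%C * 'i%C = -1 :> R[i] by rewrite -expr2 sqr_i.
rewrite !mul1r in h1; rewrite ii mulN1r in h2.
rewrite !mulN1r mulNr in h3; rewrite (mulNr 'i%C 'i%C) ii opprK mul1r mulNr in h4.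
have := Y1 1 N u1; have := Y1 'i%C N ui.
have := Y1 (- 1) N (etrans (rnormN _) u1); have := Y1 (- 'i%C) N (etrans (rnormN _) ui).
move: h1 h2 h3 h4 (X1 N); rewrite {ii ui u1}.
move: (Y 1 N) (Y 'i%C N) (Y (-1) N) (Y (- 'i%C) N) (X N).
move: (trapz N (q 1) 0 v) (trapz N (q 1) 0 ('i%C * v)).
move: (trapz N (q 1) 0 (- v)) (trapz N (q 1) 0 (- ('i%C * v))).
move=> t3 t4 t1 t2 y1 y2 y3 y4 x h1 h2 h3 h4 x1 b4 b3 b2 b1.
have : rnorm (4 * (f 0 * x)) <= 8 * M + 4 * e.
  have -> : 4 * (f 0 * x) = (y1 + y2 + (y3 + y4)) -
    ((t1 + (y1 - f 0 * x) - t2) + (t2 + (y2 - f 0 * x) - t3) +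
     ((t3 + (y3 - f 0 * x) - t4) + (t4 + (y4 - f 0 * x) - t1))) by ring.
  apply: le_trans (rnormB _ _) _.
  have T (s1 s2 s3 s4 : R[i]) : rnorm (s1 + s2 + (s3 + s4)) <=
      rnorm s1 + rnorm s2 + (rnorm s3 + rnorm s4).
    by apply: le_trans (rnormD _ _) _; apply: lerD; exact: rnormD.
  have := T y1 y2 y3 y4.
  have := T (t1 + (y1 - f 0 * x) - t2) (t2 + (y2 - f 0 * x) - t3)
     (t3 + (y3 - f 0 * x) - t4) (t4 + (y4 - f 0 * x) - t1).
  lra.
rewrite !rnormM -(rmorph_nat (real_complex R)) rnorm_real ger0_norm //.
have : rnorm (f 0) * 1 <= rnorm (f 0) * rnorm x by rewrite ler_wpM2l ?rnorm_ge0.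
lra.
Qed.

End annulus.

Lemma le_of_expr_le (x y k : R) : 0 <= x -> 0 <= y -> 0 <= k ->
  (forall n, x ^+ n <= k * y ^+ n) -> x <= y.
Proof.
move=> x0 y0 k0 h; rewrite leNgt; apply/negP => yx.
have [y00|yn0] := eqVneq y 0.
  by have := h 1; rewrite y00 !expr1 mulr0; lra.
have yp : 0 < y by rewrite lt_neqAle eq_sym yn0.
have H n : 1 + n%:R * (x / y - 1) <= k.
  have t1 : 0 <= x / y - 1 by rewrite subr_ge0 ler_pdivlMr // mul1r ltW.
  apply: (@le_trans _ _ ((x / y) ^+ n)); last first.
    by rewrite expr_div_n ler_pdivrMr ?exprn_gt0.
  set t := x / y - 1 in t1 *; have -> : x / y = 1 + t by rewrite /t addrC subrK.
  elim: n => [|n IH]; first by rewrite mul0r addr0 expr0.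
  rewrite exprS -natr1.
  have : (1 + t) * (1 + n%:R * t) <= (1 + t) * (1 + t) ^+ n.
    by rewrite ler_wpM2l // addr_ge0.
  have : 0 <= n%:R * t * t by rewrite !mulr_ge0.
  lra.
have t0 : 0 < x / y - 1 by rewrite subr_gt0 ltr_pdivlMr // mul1r.
have := archi_boundP (normr_ge0 (k / (x / y - 1))); set n := Num.bound _.
move=> /(le_lt_trans (ler_norm _)); rewrite ltr_pdivrMr //.
by have := H n; lra.
Qed.

(** The factor 2 does not depend on [f]: apply the bound to [f ^ n] and take [n]-th
    roots. *)
Lemma annulus_bound f (r B a M : R) :
  (forall z, rnorm z < r -> cdiff f z) -> (forall z, rnorm z < r -> rnorm (f z) <= B) ->
  0 < a -> 2 * a < r ->
  (forall z, a <= rnorm z <= 2 * a -> rnorm (f z) <= M) -> rnorm (f 0) <= M.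
Proof.
move=> df fB a0 ar fM.
have M0 : 0 <= M.
  apply: le_trans (rnorm_ge0 _) (fM a%:C%C _).
  by rewrite rnorm_real (ger0_norm (ltW a0)) lexx /=; lra.
apply: (@le_of_expr_le _ _ 2) => // [|n]; first exact: rnorm_ge0.
rewrite -rnormX.
apply: (@annulus_bound_double (fun z => f z ^+ n) r (B ^+ n) _ _ a) => // z hz.
- exact/cdiffX/df.
- by rewrite rnormX lerXn2r ?nnegrE ?rnorm_ge0 ?fB //; exact: le_trans (rnorm_ge0 _) (fB _ hz).
- by rewrite rnormX lerXn2r ?nnegrE ?rnorm_ge0 ?fM.
Qed.

Lemma rnorm_dist (E : normedZmodType R[i]) (x y : E) :
  `|rnorm x - rnorm y| <= rnorm (x - y).
Proof.
have := rnormD (x - y) y; have := rnormB x (x - y).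
by rewrite subrK opprB addrC subrK ler_norml; lra.
Qed.

Lemma rnorm_continuous (E : normedModType R[i]) :
  continuous (fun x : E => rnorm x : R).
Proof.
move=> x P /nbhs_ballP[d /= d0 dP].
apply/nbhs_rnormP; exists d => // y yx; apply: dP.
by rewrite -ball_normE /ball_ /=; apply: le_lt_trans (rnorm_dist _ _) _; rewrite rnormC.
Qed.

(** The disc is a closed subset of the image of a compact square of [R * R]. *)
Lemma disc_compact (r : R) : compact [set z : C | rnorm z <= r].
Proof.
pose J (u : R * R) : C := Complex u.1 u.2.
have Jc : continuous J.
  move=> u; move=> P /nbhs_rnormP[d d0 dP].
  have d20 : 0 < d / 2 by rewrite divr_gt0.
  exists (ball u.1 (d / 2), ball u.2 (d / 2)).
    by split; exact: nbhsx_ballx.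
  move=> [x y] [/= hx hy]; apply: dP.
  apply: le_lt_trans (rnorm_le _) _ => /=.
  move: hx hy; rewrite -!ball_normE /ball_ /= => hx hy.
  by rewrite distrC (distrC y) [ltRHS]splitr ltrD.
pose S := (`[- r, r] `*` `[- r, r])%classic : set (R * R).
have cS : compact (J @` S).
  apply: continuous_compact; first exact: continuous_subspaceT.
  by apply: compact_setX; exact: segment_compact.
apply: subclosed_compact cS _.
  move=> p Kp /=; rewrite leNgt; apply/negP => rp.
  have [|z [/= zr zp]] := Kp [set z : C | rnorm (z - p) < rnorm p - r].
    by apply/nbhs_rnormP; exists (rnorm p - r) => //; rewrite subr_gt0.
  by have := rnormB z (z - p); rewrite opprB addrCA subrr addr0; lra.
move=> z /= zr; exists (complex.Re z, complex.Im z); last by case: z {zr}.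
split => /=; rewrite in_itv /= -ler_norml; apply: le_trans zr; [exact: rnorm_Re|exact: rnorm_Im].
Qed.

Lemma disc_max (g : R[i] -> R) (r : R) : 0 <= r ->
  (forall z, rnorm z <= r -> {for z, continuous (g : C -> R)}) ->
  exists2 p, rnorm p <= r & forall z, rnorm z <= r -> g z <= g p.
Proof.
move=> r0 gc.
have [|||p pD pmax] := @compact_EVT_max C R g [set z : C | rnorm z <= r].
- by exists 0; rewrite /= rnorm0.
- exact: disc_compact.
- by apply: continuous_in_subspaceT => z; rewrite inE; exact: gc.
- exists p; first by rewrite inE in pD.
  by move=> z zr; apply: pmax; rewrite inE.
Qed.

Let dot z w := complex.Re z * complex.Re w + complex.Im z * complex.Im w.

Let rnormD_sqr z w : rnorm (z + w) ^+ 2 = rnorm z ^+ 2 + 2 * dot z w + rnorm w ^+ 2.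
Proof. by rewrite !rnorm_sqr /dot; case: z w => a b [c d] /=; ring. Qed.

Let dot_le z w : `|dot z w| <= rnorm z * rnorm w.
Proof.
have -> : dot z w = complex.Re (z^*%C * w) by case: z w => a b [c d] /=; rewrite /dot /=; ring.
apply: le_trans (rnorm_Re _) _; rewrite rnormM.
suff -> : rnorm z^*%C = rnorm z by [].
by case: z => a b; rewrite /rnorm !normc_def /= sqrrN.
Qed.

(** Where [|F|^2 + e |z|^2] is maximal, [F] can be multiplied by an affine function
    [1 + k t] of the displacement [t] so that the modulus of the product [H]
    decreases quadratically in [|t|], which contradicts [annulus_bound].  At 0 only
    continuity and [F 0 = 0] are assumed: such a point is not the maximum, and this
    allows quotients by powers of [z]. *)
Lemma max_principle (F : R[i] -> R[i]) (r m : R) : 0 < r ->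
  (forall z, rnorm z <= r -> {for z, continuous (F : C -> C)}) ->
  (forall z, z != 0 -> rnorm z < r -> cdiff F z) -> F 0 = 0 ->
  (forall z, rnorm z = r -> rnorm (F z) <= m) ->
  forall z, rnorm z <= r -> rnorm (F z) <= m.
Proof.
move=> r0 cF dF F0 Fm a ar; rewrite leNgt; apply/negP => ma.
have m0 : 0 <= m.
  by apply: le_trans (rnorm_ge0 _) (Fm r%:C%C _); rewrite rnorm_real (ger0_norm (ltW r0)).
have a2 : m ^+ 2 < rnorm (F a) ^+ 2 by rewrite ltrXn2r ?nnegrE ?rnorm_ge0.
(* half of the largest penalty that keeps the maximum off the circle *)
pose e := (rnorm (F a) ^+ 2 - m ^+ 2) / (2 * r ^+ 2).
have r20 : 0 < r ^+ 2 by rewrite exprn_gt0.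
have e0 : 0 < e by rewrite divr_gt0 ?subr_gt0 ?mulr_gt0.
have er : e * r ^+ 2 = (rnorm (F a) ^+ 2 - m ^+ 2) / 2.
  by rewrite /e; field; rewrite gt_eqF.
pose Psi z := rnorm (F z) ^+ 2 + e * rnorm z ^+ 2.
have [|p pr pmax] := @disc_max Psi r (ltW r0).
  move=> z zr.
  have c1 : {for z, continuous (fun z : C => rnorm (F z))}.
    by apply: continuous_comp (cF z zr) _; exact: rnorm_continuous.
  have c2 : {for z, continuous (fun z : C => rnorm z : R)} by exact: rnorm_continuous.
  have c3 : {for (z : C), continuous (fun _ : C => e)} by exact: (@cst_continuous C R).
  have -> : (Psi : C -> R) =
      ((fun w => rnorm (F w)) \* (fun w => rnorm (F w))) +
      ((fun _ : C => e) \* ((fun w : C => rnorm w) \* (fun w : C => rnorm w))).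
    by apply/funext => w; rewrite /Psi !expr2.
  exact: (continuousD (continuousM c1 c1) (continuousM c3 (continuousM c2 c2))).
have pa : rnorm (F a) ^+ 2 <= Psi p.
  by apply: le_trans (pmax a ar); rewrite lerDl mulr_ge0 ?sqr_ge0 // ltW.
have p_lt : rnorm p < r.
  rewrite lt_neqAle pr andbT; apply/eqP => pE.
  have := pa; rewrite /Psi pE er.
  have : rnorm (F p) ^+ 2 <= m ^+ 2 by rewrite lerXn2r ?nnegrE ?rnorm_ge0 ?Fm.
  lra.
have p0 : p != 0.
  apply/eqP => p0; move: pa; rewrite /Psi p0 F0 rnorm0 expr0n /=.
  by have := sqr_ge0 m; lra.
have np0 : 0 < rnorm p by rewrite rnorm_gt0.
set A := rnorm (F p) ^+ 2; set P := rnorm p ^+ 2.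
have P0 : 0 < P by rewrite exprn_gt0.
have Pr : P < r ^+ 2 by rewrite ltrXn2r ?nnegrE ?rnorm_ge0 // ltW.
have ePr : e * P < e * r ^+ 2 by rewrite ltr_pM2l.
have eP0 : 0 < e * P by rewrite mulr_gt0.
have PA : e * P < A.
  by move: pa; rewrite /Psi -/A -/P; have := sqr_ge0 m; lra.
have A0 : 0 < A by exact: lt_trans PA.
pose th := e * P / A.
have th0 : 0 < th by rewrite divr_gt0.
have th1 : th < 1 by rewrite ltr_pdivrMr // mul1r.
pose b := Num.min ((r - rnorm p) / 3) (Num.min (rnorm p / 3) ((1 - th) * A / (24 * e * r))).
have b0 : 0 < b.
  have t1 : 0 < (1 - th) * A by apply: mulr_gt0 => //; rewrite subr_gt0.
  have t2 : 0 < 24 * e * r by apply: mulr_gt0 => //; apply: mulr_gt0.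
  rewrite !lt_min (divr_gt0 t1 t2) andbT; apply/andP; split; lra.
have [b1 b2 b3] : [/\ 3 * b <= r - rnorm p, 3 * b <= rnorm p &
    24 * e * r * b <= (1 - th) * A].
  have l1 : b <= (r - rnorm p) / 3 by rewrite ge_min lexx.
  have l2 : b <= rnorm p / 3 by rewrite !ge_min lexx !orbT.
  have l3 : b <= (1 - th) * A / (24 * e * r) by rewrite !ge_min lexx !orbT.
  split; [lra|lra|].
  have q0 : 0 < 24 * e * r by apply: mulr_gt0 => //; apply: mulr_gt0.
  by move: l3; rewrite ler_pdivlMr // mulrC.
(* cancels the first order term of the penalty [e |p + t|^2] *)
pose k : R[i] := (e / A)%:C%C * p^*%C.
pose H t := F (p + t) * (1 + k * t).
have HE t : rnorm t < 3 * b ->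
    rnorm (H t) ^+ 2 <= A - e * (1 - th) / 2 * rnorm t ^+ 2.
  move=> tb; rewrite /H rnormM exprMn.
  set T := rnorm t ^+ 2; set s := dot p t.
  have T0 : 0 <= T by exact: sqr_ge0.
  have hF : rnorm (F (p + t)) ^+ 2 <= A * (1 - 2 * e * s / A - e * T / A).
    have ptr : rnorm (p + t) <= r by have := rnormD p t; lra.
    have := pmax _ ptr; rewrite /Psi rnormD_sqr -/A -/P -/T -/s.
    have -> : A * (1 - 2 * e * s / A - e * T / A) = A - 2 * e * s - e * T.
      by field; rewrite gt_eqF.
    lra.
  have -> : rnorm (1 + k * t) ^+ 2 = 1 + 2 * e * s / A + th * (e * T / A).
    rewrite /th /T /s /P /k !rnorm_sqr /dot; case: (p) (t) => x y [u v] /=.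
    by simpc => /=; field; rewrite gt_eqF.
  set x := 2 * e * s / A in hF *; set y := e * T / A in hF *.
  have y0 : 0 <= y := divr_ge0 (mulr_ge0 (ltW e0) T0) (ltW A0).
  have eA0 : 0 <= 2 * e / A := divr_ge0 (mulr_ge0 (ler0n R 2) (ltW e0)) (ltW A0).
  have hx : `|x| <= (1 - th) / 4.
    have -> : x = 2 * e / A * s by rewrite /x; field; rewrite gt_eqF.
    rewrite normrM (ger0_norm eA0).
    apply: (@le_trans _ _ (2 * e / A * (r * (3 * b)))).
      rewrite (ler_wpM2l eA0) //.
      by apply: le_trans (dot_le _ _) _; apply: ler_pM; rewrite ?rnorm_ge0 // ltW.
    rewrite mulrAC ler_pdivrMr //; lra.
  have eT : e * (1 - th) / 2 * T = A * (y * (1 - th) / 2).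
    by rewrite /y; field; rewrite gt_eqF.
  have L0 : 0 <= 1 + x + th * y.
    by have := mulr_ge0 (ltW th0) y0; move: hx; rewrite ler_norml => /andP[]; lra.
  rewrite eT; apply: le_trans (ler_wpM2r L0 hF) _.
  have -> : A - A * (y * (1 - th) / 2) = A * (1 - y * (1 - th) / 2) by ring.
  rewrite -(mulrA A) ler_pM2l //.
  move: hx; rewrite ler_norml => /andP[x1 x2].
  have hxy : 0 <= y * ((1 - th) / 2 + x * (1 + th)).
    apply: mulr_ge0 => //.
    have : - ((1 - th) / 4) * (1 + th) <= x * (1 + th) by rewrite ler_wpM2r //; lra.
    have : 0 <= (1 - th) * (1 - th) by rewrite mulr_ge0 //; lra.
    lra.
  have : 0 <= x ^+ 2 + th * (y ^+ 2) := addr_ge0 (sqr_ge0 x) (mulr_ge0 (ltW th0) (sqr_ge0 y)).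
  lra.
have nA : rnorm (F p) = Num.sqrt A by rewrite sqrtr_sqr ger0_norm ?rnorm_ge0.
have le_sqrt x y : 0 <= x -> x ^+ 2 <= y -> x <= Num.sqrt y.
  by move=> x0 xy; rewrite -(ger0_norm x0) -sqrtr_sqr ler_wsqrtr.
pose c := e * (1 - th) / 2 * b ^+ 2.
have e10 : 0 < e * (1 - th) / 2 by apply: divr_gt0 => //; apply: mulr_gt0 => //; rewrite subr_gt0.
have c0 : 0 < c := mulr_gt0 e10 (exprn_gt0 2 b0).
have sc : A - c < A by rewrite gtrBl.
have : rnorm (H 0) <= Num.sqrt (A - c).
  apply: (@annulus_bound H (3 * b) (Num.sqrt A) b _ _ _ b0).
  - move=> t tb; apply: cdiffM.
      apply: cdiff_shift; apply: dF.
        apply/eqP => pt; have := rnormB (p + t) t; rewrite addrK pt rnorm0; lra.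
      by have := rnormD p t; lra.
    apply: cdiffD; first exact: cdiff_cst.
    by apply: cdiffM; [exact: cdiff_cst|exact: cdiff_id].
  - move=> t tb; apply: le_sqrt; first exact: rnorm_ge0.
    apply: le_trans (HE t tb) _; rewrite gerBl.
    exact: mulr_ge0 (ltW e10) (sqr_ge0 _).
  - lra.
  - move=> t /andP[t1 t2]; apply: le_sqrt; first exact: rnorm_ge0.
    apply: le_trans (HE t _) _; first lra.
    rewrite lerB // /c (ler_wpM2l (ltW e10)) //.
    by rewrite lerXn2r ?nnegrE ?rnorm_ge0 ?(ltW b0).
rewrite /H addr0 mulr0 addr0 mulr1 nA leNgt ltr_sqrt //.
by rewrite sc.
Qed.

(** The maximum principle for [f ^ n.+1 / z ^ n] on [|z| = s] gives
    [|f z| ^ n.+1 <= M (M |z| / s) ^ n]; let [n] tend to infinity, then [s] to [r].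
    Powers are used because [f / z] itself is not known to be differentiable at 0. *)
Lemma schwarz f (r M : R) :
  (forall z, rnorm z < r -> cdiff f z) -> f 0 = 0 ->
  (forall z, rnorm z < r -> rnorm (f z) <= M) ->
  forall z, rnorm z < r -> rnorm (f z) <= M * rnorm z / r.
Proof.
move=> df f0 fM z zr.
have r0 : 0 < r by exact: le_lt_trans (rnorm_ge0 z) zr.
have M0 : 0 <= M by exact: le_trans (rnorm_ge0 _) (fM z zr).
have [B hB] := quotient_bounded df fM r0.
suff H s : rnorm z < s -> s < r -> rnorm (f z) <= M * rnorm z / s.
  rewrite ler_pdivlMr // leNgt; apply/negP => h.
  have fz0 : 0 < rnorm (f z).
    rewrite lt_neqAle rnorm_ge0 andbT eq_sym; apply/eqP => h0.
    by move: h; rewrite h0 mul0r ltNge mulr_ge0 ?rnorm_ge0.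
  pose s := Num.max ((rnorm z + r) / 2) ((M * rnorm z / rnorm (f z) + r) / 2).
  have q1 : M * rnorm z / rnorm (f z) < r by rewrite ltr_pdivrMr // (mulrC r).
  have s1 : rnorm z < s by rewrite lt_max; apply/orP; left; lra.
  have s2 : s < r by rewrite gt_max; apply/andP; split; lra.
  have s3 : M * rnorm z / rnorm (f z) < s by rewrite lt_max; apply/orP; right; lra.
  have := H s s1 s2; rewrite ler_pdivlMr; last exact: le_lt_trans (rnorm_ge0 z) s1.
  by move: s3; rewrite ltr_pdivrMr // mulrC; lra.
move=> zs sr; have s0 : 0 < s by exact: le_lt_trans (rnorm_ge0 z) zs.
have [fz0|fzn0] := eqVneq (rnorm (f z)) 0.
  by rewrite fz0 divr_ge0 ?mulr_ge0 ?rnorm_ge0 // ltW.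
have fz0 : 0 < rnorm (f z) by rewrite lt_neqAle rnorm_ge0 eq_sym fzn0.
apply: (@le_of_expr_le _ _ (M / rnorm (f z))).
- exact: rnorm_ge0.
- by rewrite divr_ge0 ?mulr_ge0 ?rnorm_ge0 // ltW.
- by rewrite divr_ge0 ?rnorm_ge0.
move=> n; rewrite mulrAC ler_pdivlMr // -exprSr.
pose G w := f w ^+ n.+1 * (w^-1) ^+ n.
have G0 : G 0 = 0 by rewrite /G f0 expr0n mul0r.
have zn0 : z != 0.
  by apply/eqP => z0; move: fz0; rewrite z0 f0 rnorm0 ltxx.
have dG w : w != 0 -> rnorm w < r -> cdiff G w.
  move=> w0 wr; apply: cdiffM; first exact/cdiffX/df.
  by apply/cdiffX/cdiffV => //; exact: cdiff_id.
have : rnorm (G z) <= M ^+ n.+1 / s ^+ n.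
  apply: (@max_principle G s _ s0 _ _ G0 _ z (ltW zs)).
  - move=> w ws; have [->|w0] := eqVneq w 0; last first.
      by apply: differentiable_continuous; apply: dG => //; exact: le_lt_trans sr.
    apply/continuous_rnormP => e e0; rewrite G0.
    have df0 : cdiff f 0 by apply: df; rewrite rnorm0.
    have B1 : 0 < `|B| ^+ n + 1 by rewrite ltr_wpDl // exprn_ge0.
    have /continuous_rnormP/(_ _ (divr_gt0 e0 B1))[d d0 hd] :=
      differentiable_continuous df0.
    exists (Num.min d r); first by rewrite lt_min d0.
    move=> y; rewrite lt_min !subr0 => /andP[yd yr].
    rewrite /G exprS -mulrA -exprMn rnormM rnormX.
    have := hd y; rewrite f0 !subr0 => /(_ yd) h.
    have hq : rnorm (f y * y^-1) <= `|B|.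
      by have := hB y yr; rewrite f0 subr0 => /le_trans; apply; exact: ler_norm.
    apply: (@le_lt_trans _ _ (rnorm (f y) * (`|B| ^+ n + 1))).
      rewrite ler_wpM2l ?rnorm_ge0 //; apply: ler_wpDr => //.
      by rewrite lerXn2r ?nnegrE ?rnorm_ge0.
    by rewrite -ltr_pdivlMr.
  - by move=> w w0 ws; apply: dG => //; exact: lt_trans sr.
  - move=> w ws; rewrite /G rnormM !rnormX rnormV ws exprVn.
    rewrite ler_pM2r ?invr_gt0 ?exprn_gt0 // lerXn2r ?nnegrE ?rnorm_ge0 //.
    by apply: fM; rewrite ws.
rewrite /G rnormM !rnormX rnormV exprVn.
have nz : 0 < rnorm z ^+ n by rewrite exprn_gt0 // rnorm_gt0.
rewrite ler_pdivrMr // => /le_trans; apply.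
by rewrite expr_div_n exprMn exprS le_eqVlt; apply/orP; left; apply/eqP; ring.
Qed.

End maxmod.

(** * Cauchy estimates on complex normed spaces *)

Section several.
Variables (R : realType) (E : normedModType R[i]).
Local Notation C := (R[i])^o.
Local Notation cdiff f p := (differentiable (f : C -> C) (p : C)).
Implicit Types (f g : E -> C) (x y k v : E).

Lemma differentiable_shift (F G : normedModType R[i]) (f : F -> G) (a x : F) :
  differentiable f (x + a) -> differentiable (fun z : F => f (z + a)) x.
Proof.
move=> df; apply: (@differentiable_comp _ _ _ _ (fun z : F => z + a)) df.
by apply: differentiableD => //; exact: differentiable_cst.
Qed.

Lemma cdiff_line f x k (z : R[i]) :
  differentiable f (x + z *: k) -> cdiff (fun z : R[i] => f (x + z *: k)) z.
Proof.
move=> df; apply: (@differentiable_comp _ C E C (fun z : C => x + z *: k) f z) df.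
apply: differentiableD; first exact: differentiable_cst.
by apply: differentiableZl; have [] := is_diff_id (z : C).
Qed.

Lemma schwarz_line f x k (r M : R) :
  (forall y, rnorm (y - x) < r -> differentiable f y) ->
  (forall y, rnorm (y - x) < r -> rnorm (f y - f x) <= M) ->
  rnorm k < r -> rnorm (f (x + k) - f x) <= M * rnorm k / r.
Proof.
move=> df fM kr; have [->|k0] := eqVneq k 0.
  by rewrite addr0 subrr !rnorm0 mulr0 mul0r.
have nk : 0 < rnorm k by rewrite rnorm_gt0.
have r0 : 0 < r := lt_trans nk kr.
have zk (z : R[i]) : rnorm z < r / rnorm k -> rnorm (x + z *: k - x) < r.
  by rewrite addrC addKr rnormZ ltr_pdivlMr.
have -> : M * rnorm k / r = M * rnorm (1 : R[i]) / (r / rnorm k).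
  by rewrite rnorm1; field; rewrite !gt_eqF.
rewrite -[in f (x + k)](scale1r k).
apply: (@schwarz R (fun z => f (x + z *: k) - f x) (r / rnorm k) M).
- move=> z hz; apply: cdiffB; last exact: cdiff_cst.
  by apply: cdiff_line; exact: df (zk z hz).
- by rewrite scale0r addr0 subrr.
- by move=> z hz; exact: fM (zk z hz).
- by rewrite rnorm1 ltr_pdivlMr // mul1r.
Qed.

Lemma bounded_lipschitz f x k (r M : R) :
  (forall y, rnorm (y - x) < r -> differentiable f y) ->
  (forall y, rnorm (y - x) < r -> rnorm (f y) <= M) ->
  rnorm k < r -> rnorm (f (x + k) - f x) <= 2 * M * rnorm k / r.
Proof.
move=> df fM kr; apply: schwarz_line => // y yr.
have xr : rnorm (x - x) < r by rewrite subrr rnorm0; exact: le_lt_trans (rnorm_ge0 _) kr.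
by have := rnormB (f y) (f x); have := fM _ yr; have := fM _ xr; lra.
Qed.

Lemma diff_scale f x v (w : R[i]) : 'd f x (w *: v) = w * ('d f x v : R[i]).
Proof. exact: linearZ. Qed.

(** The odd part [phi] of [f] along [v] vanishes at 0, has the same bound and the
    same derivative there, so the Schwarz lemma gives the sharp constant. *)
Lemma cauchy_estimate f x v (r M : R) : 0 < r ->
  (forall y, rnorm (y - x) < r -> differentiable f y) ->
  (forall y, rnorm (y - x) < r -> rnorm (f y) <= M) ->
  rnorm ('d f x v) <= M * rnorm v / r.
Proof.
move=> r0 df fM; have xr : rnorm (x - x) < r by rewrite subrr rnorm0.
have M0 : 0 <= M := le_trans (rnorm_ge0 _) (fM _ xr).
have [->|v0] := eqVneq v 0; first by rewrite linear0 !rnorm0 mulr0 mul0r.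
have nv : 0 < rnorm v by rewrite rnorm_gt0.
apply/ler_addgt0Pr => e e0.
have [d d0 hd] := differentiable_rnorm (df _ xr) (divr_gt0 e0 nv).
pose s := Num.min d r / (2 * rnorm v).
have m0 : 0 < Num.min d r by rewrite lt_min d0.
have s0 : 0 < s by rewrite divr_gt0 // mulr_gt0.
have sv : s * rnorm v < Num.min d r.
  have -> : s * rnorm v = Num.min d r / 2 by rewrite /s; field; rewrite gt_eqF.
  lra.
move: sv; rewrite lt_min => /andP[sd sr].
pose z : R[i] := s%:C%C.
have nz : rnorm z = s by rewrite rnorm_real gtr0_norm.
have nzv : rnorm (z *: v) = s * rnorm v by rewrite rnormZ nz.
have zv (w : R[i]) : rnorm w < r / rnorm v -> rnorm (x + w *: v - x) < r.
  by rewrite addrC addKr rnormZ ltr_pdivlMr.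
pose phi (w : R[i]) : R[i] := (f (x + w *: v) - f (x + (- w) *: v)) / 2.
have hphi : rnorm (phi z) <= M * s / (r / rnorm v).
  rewrite -nz; apply: (@schwarz R phi (r / rnorm v) M).
  - move=> w hw; apply: cdiffM; last exact: cdiff_cst.
    apply: cdiffB; first by apply: cdiff_line; exact: df (zv _ hw).
    apply: (@cdiff_comp R (fun w => - w) (fun w => f (x + w *: v))).
      by apply: differentiableN; have [] := is_diff_id (w : C).
    by apply: cdiff_line; apply: df; apply: zv; rewrite rnormN.
  - by rewrite /phi oppr0 subrr mul0r.
  - move=> w hw; rewrite /phi rnormM rnormV rnorm2.
    have hw' : rnorm (- w) < r / rnorm v by rewrite rnormN.
    have := rnormB (f (x + w *: v)) (f (x + (- w) *: v)).
    by have := fM _ (zv _ hw); have := fM _ (zv _ hw'); lra.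
  - by rewrite nz ltr_pdivlMr.
have h1 := hd (x + z *: v); have h2 := hd (x + (- z) *: v).
move: h1 h2; rewrite ![x + _ + - x]addrC !addKr !rnormZ rnormN nz => /(_ sd) h1 /(_ sd) h2.
move: h1 h2; rewrite !diff_scale.
set A := f (x + z *: v); set B := f (x + (- z) *: v).
set D := f x; set L := 'd f x v => h1 h2.
rewrite mulNr in h2.
have e1 : e / rnorm v * (s * rnorm v) = e * s by field; rewrite gt_eqF.
rewrite e1 in h1 h2.
have : rnorm (z * L) <= M * s / (r / rnorm v) + e * s.
  have -> : z * L = phi z - ((A - D - z * L) - (B - D - - (z * L))) / 2.
    by rewrite /phi -/A -/B; field.
  apply: le_trans (rnormB _ _) _; apply: lerD => //.
  rewrite rnormM rnormV rnorm2.
  by have := rnormB (A - D - z * L) (B - D - - (z * L)); lra.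
rewrite rnormM nz.
have -> : M * s / (r / rnorm v) + e * s = s * (M * rnorm v / r + e).
  by field; rewrite !gt_eqF.
by rewrite ler_pM2l.
Qed.

(** The Lipschitz estimate for [f] bounds the increment of [f] by [l], and the
    same estimate for this increment bounds its own increment by [k]. *)
Lemma second_difference f x k l (r M : R) :
  (forall y, rnorm (y - x) < r -> differentiable f y) ->
  (forall y, rnorm (y - x) < r -> rnorm (f y) <= M) ->
  rnorm k < r / 2 -> rnorm l < r / 2 ->
  rnorm (f (x + k + l) - f (x + k) - (f (x + l) - f x)) <=
    16 * M * rnorm k * rnorm l / r ^+ 2.
Proof.
move=> df fM kr lr.
have r0 : 0 < r by have := rnorm_ge0 k; lra.
have sub y y' : rnorm (y - x) < r / 2 -> rnorm (y' - y) < r / 2 -> rnorm (y' - x) < r.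
  by move=> h1 h2; have := rnormD (y' - y) (y - x); rewrite addrA subrK; lra.
have yx y : rnorm (y - x) < r / 2 -> rnorm (y - x) < r by lra.
have yl y : rnorm (y - x) < r / 2 -> rnorm (y + l - x) < r.
  by move=> h; apply: (sub _ _ h); rewrite addrC addKr.
have -> : 16 * M * rnorm k * rnorm l / r ^+ 2 =
    2 * (2 * M * rnorm l / (r / 2)) * rnorm k / (r / 2) by field; rewrite gt_eqF.
apply: (@bounded_lipschitz (fun y => f (y + l) - f y) x k (r / 2) _ _ _ kr) => y hy.
  apply: differentiableB; last exact: df (yx _ hy).
  by apply: differentiable_shift; exact: df (yl _ hy).
by apply: bounded_lipschitz => // y' hy'; [apply: df|apply: fM]; exact: sub hy'.
Qed.

Lemma half_pow_real (j : nat) : (2 ^- j : R[i]) = (2 ^- j : R)%:C%C.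
Proof. by rewrite fmorphV rmorphXn rmorph_nat. Qed.

Lemma rnorm_half_pow (j : nat) : rnorm (2 ^- j : R[i]) = 2 ^- j.
Proof. by rewrite half_pow_real rnorm_real ger0_norm // invr_ge0 exprn_ge0. Qed.

(** By [second_difference], the increment [D] of [f] satisfies
    [D k = 2 D (k / 2)] up to a multiple of [|k|^2].  The errors along
    [2 ^ j D (k / 2 ^ j)], which tends to the derivative along [k], form a
    geometric series. *)
Lemma quadratic_remainder f x k (r M : R) :
  (forall y, rnorm (y - x) < r -> differentiable f y) ->
  (forall y, rnorm (y - x) < r -> rnorm (f y) <= M) ->
  rnorm k < r -> rnorm (f (x + k) - f x - 'd f x k) <= 8 * M * rnorm k ^+ 2 / r ^+ 2.
Proof.
move=> df fM kr.
have r0 : 0 < r by have := rnorm_ge0 k; lra.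
pose kj (j : nat) := (2 ^- j : R[i]) *: k.
have nkj j : rnorm (kj j) = 2 ^- j * rnorm k by rewrite rnormZ rnorm_half_pow.
pose D y : R[i] := f (x + y) - f x.
have p2 j : 0 < 2 ^- j :> R by rewrite invr_gt0 exprn_gt0.
have p2_le j : 2 ^- j <= 1 :> R by rewrite invf_le1 ?exprn_gt0 // exprn_ege1 // ler1n.
have pS j : 2 ^- j.+1 = 2 ^- j / 2 :> R by rewrite exprS invfM mulrC.
have kjS j : kj j = kj j.+1 + kj j.+1.
  by rewrite /kj -scalerDl exprS; congr (_ *: _); field; rewrite expf_neq0 ?pnatr_eq0.
have step j : rnorm (D (kj j) - 2 * D (kj j.+1)) <= 4 * M * (2 ^- j * rnorm k) ^+ 2 / r ^+ 2.
  have hj : rnorm (kj j.+1) < r / 2.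
    rewrite nkj pS; have : 2 ^- j * rnorm k <= 1 * rnorm k by rewrite ler_wpM2r ?rnorm_ge0.
    lra.
  have := second_difference df fM hj hj.
  have -> : x + kj j.+1 + kj j.+1 = x + kj j by rewrite -addrA -kjS.
  have -> : f (x + kj j) - f (x + kj j.+1) - (f (x + kj j.+1) - f x) =
     D (kj j) - 2 * D (kj j.+1) by rewrite /D; ring.
  move=> /le_trans; apply; rewrite nkj pS le_eqVlt; apply/orP; left; apply/eqP.
  by field; rewrite ?(gt_eqF r0) ?expf_neq0 ?pnatr_eq0.
have ind j : rnorm (D k - 2 ^+ j * D (kj j)) <= 8 * M * rnorm k ^+ 2 / r ^+ 2 * (1 - 2 ^- j).
  elim: j => [|j IH].
    by rewrite /kj !expr0 !invr1 scale1r mul1r !subrr rnorm0 mulr0.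
  have -> : D k - 2 ^+ j.+1 * D (kj j.+1) =
     D k - 2 ^+ j * D (kj j) + 2 ^+ j * (D (kj j) - 2 * D (kj j.+1)).
    by rewrite exprS; ring.
  apply: le_trans (rnormD _ _) _; rewrite rnormM rnormX rnorm2.
  have : 2 ^+ j * rnorm (D (kj j) - 2 * D (kj j.+1)) <=
      2 ^+ j * (4 * M * (2 ^- j * rnorm k) ^+ 2 / r ^+ 2).
    by rewrite ler_wpM2l ?exprn_ge0.
  have -> : 2 ^+ j * (4 * M * (2 ^- j * rnorm k) ^+ 2 / r ^+ 2) =
     4 * M * rnorm k ^+ 2 / r ^+ 2 * 2 ^- j.
    by field; rewrite ?(gt_eqF r0) ?expf_neq0 ?pnatr_eq0.
  by rewrite pS; lra.
have M0 : 0 <= M.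
  by apply: le_trans (rnorm_ge0 _) (fM x _); rewrite subrr rnorm0.
apply/ler_addgt0Pr => e e0.
have xr : rnorm (x - x) < r by rewrite subrr rnorm0.
have k1 : 0 < rnorm k + 1 by rewrite ltr_wpDl ?rnorm_ge0.
have e1 : 0 < e / (rnorm k + 1) := divr_gt0 e0 k1.
have [d d0 hd] := differentiable_rnorm (df _ xr) e1.
have [j hj] := half_pow_small (rnorm k) d0.
have := hd (x + kj j); rewrite [x + _ - x]addrC addKr nkj mulrC hj => /(_ isT).
rewrite -/(D _) diff_scale.
set L : R[i] := 'd f x k => h.
have h' : rnorm (2 ^+ j * D (kj j) - L) <= e.
  have -> : 2 ^+ j * D (kj j) - L = 2 ^+ j * (D (kj j) - 2 ^- j * L).
    by field; rewrite ?expf_neq0 ?pnatr_eq0.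
  rewrite rnormM rnormX rnorm2.
  apply: le_trans (ler_wpM2l (exprn_ge0 j (ler0n R 2)) h) _.
  have -> : 2 ^+ j * (e / (rnorm k + 1) * (rnorm k * 2 ^- j)) = e * (rnorm k / (rnorm k + 1)).
    by field; rewrite ?(gt_eqF k1) ?expf_neq0 ?pnatr_eq0.
  by rewrite ler_piMr ?(ltW e0) // ler_pdivrMr // mul1r lerDl.
have -> : f (x + k) - f x - L = (D k - 2 ^+ j * D (kj j)) + (2 ^+ j * D (kj j) - L).
  by rewrite /D; ring.
apply: le_trans (rnormD _ _) _; apply: lerD h'.
apply: le_trans (ind j) _; rewrite ler_piMr //; last by rewrite gerBl ltW.
exact: divr_ge0 (mulr_ge0 (mulr_ge0 (ler0n R 8) M0) (sqr_ge0 _)) (sqr_ge0 _).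
Qed.

(** The difference quotients [q j] of [f] along [v] are differentiable and converge
    uniformly near [x], with error [K / 2 ^ j].  Cauchy estimates turn this into
    convergence of their differentials at [x], and the quadratic remainders of the
    [q j] are bounded uniformly in [j], hence also that of the limit. *)
Lemma derive_differentiable f x v (r M : R) : 0 < r ->
  (forall y, rnorm (y - x) < r -> differentiable f y) ->
  (forall y, rnorm (y - x) < r -> rnorm (f y) <= M) ->
  differentiable (fun y => 'd f y v : C) x.
Proof.
move=> r0 df fM.
have M0 : 0 <= M.
  by apply: le_trans (rnorm_ge0 _) (fM x _); rewrite subrr rnorm0.
have v1 : 0 < rnorm v + 1 by rewrite ltr_wpDl ?rnorm_ge0.
pose c : R := r / (4 * (rnorm v + 1)).
have c0 : 0 < c by apply: divr_gt0 => //; apply: mulr_gt0.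
have cv : c * rnorm v < r / 2.
  apply: (@lt_trans _ _ (c * (rnorm v + 1))); first by rewrite ltr_pM2l // ltrDl.
  have -> : c * (rnorm v + 1) = r / 4 by rewrite /c; field; rewrite gt_eqF.
  lra.
pose s (j : nat) : R := c / 2 ^+ j.
have p2 (j : nat) : 0 < 2 ^+ j :> R by rewrite exprn_gt0.
have s0 j : 0 < s j by rewrite divr_gt0.
have sc j : s j <= c by rewrite ler_pdivrMr // ler_peMr ?(ltW c0) // exprn_ege1 // ler1n.
pose t (j : nat) : R[i] := (s j)%:C%C.
have nt j : rnorm (t j) = s j by rewrite rnorm_real gtr0_norm.
have t0 j : t j != 0 by rewrite -rnorm_gt0 nt.
have ntv j : rnorm (t j *: v) = s j * rnorm v by rewrite rnormZ nt.
have tvr j : rnorm (t j *: v) < r / 2.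
  by rewrite ntv; apply: le_lt_trans cv; rewrite ler_wpM2r ?rnorm_ge0.
pose q j y : C := (f (y + t j *: v) - f y) / t j.
have sub y y' : rnorm (y - x) < r / 2 -> rnorm (y' - y) < r / 2 -> rnorm (y' - x) < r.
  by move=> h1 h2; have := rnormD (y' - y) (y - x); rewrite addrA subrK; lra.
have yx y : rnorm (y - x) < r / 2 -> rnorm (y - x) < r by lra.
have ytv j y : rnorm (y - x) < r / 2 -> rnorm (y + t j *: v - x) < r.
  by move=> h; apply: (sub _ _ h); rewrite addrC addKr.
have dq j y : rnorm (y - x) < r / 2 -> differentiable (q j) y.
  move=> hy; apply: (@differentiableM _ E); last exact: differentiable_cst.
  apply: differentiableB; last exact: df (yx _ hy).
  by apply: differentiable_shift; exact: df (ytv _ _ hy).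
pose Q : R := 4 * M * rnorm v / r.
have qQ j y : rnorm (y - x) < r / 2 -> rnorm (q j y) <= Q.
  move=> hy; rewrite /q rnormM rnormV nt ler_pdivrMr //.
  have -> : Q * s j = 2 * M * rnorm (t j *: v) / (r / 2).
    by rewrite ntv /Q; field; rewrite gt_eqF.
  by apply: bounded_lipschitz => // y' hy'; [apply: df|apply: fM]; exact: sub hy'.
pose g y : C := 'd f y v.
pose K : R := 32 * M * rnorm v ^+ 2 / r ^+ 2 * c.
have K0 : 0 <= K.
  apply: mulr_ge0 (ltW c0); apply: divr_ge0 (sqr_ge0 _).
  exact: mulr_ge0 (mulr_ge0 (ler0n R 32) M0) (sqr_ge0 _).
have qg j y : rnorm (y - x) < r / 2 -> rnorm (q j y - g y) <= K / 2 ^+ j.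
  move=> hy.
  have := @quadratic_remainder f y (t j *: v) (r / 2) M.
  have hd y' : rnorm (y' - y) < r / 2 -> differentiable f y' by move=> h; apply: df; exact: sub h.
  have hM y' : rnorm (y' - y) < r / 2 -> rnorm (f y') <= M by move=> h; apply: fM; exact: sub h.
  move=> /(_ hd hM (tvr j)).
  have -> : f (y + t j *: v) - f y - 'd f y (t j *: v) = t j * (q j y - g y).
    by rewrite diff_scale /q /g; field; exact: t0.
  rewrite rnormM nt ntv -ler_pdivlMl // => /le_trans; apply.
  rewrite le_eqVlt; apply/orP; left; apply/eqP; rewrite /K /s.
  by field; rewrite ?(gt_eqF r0) ?(gt_eqF c0) ?(gt_eqF (p2 j)).
have xx : rnorm (x - x) < r / 2 by rewrite subrr rnorm0; lra.
have r20 : 0 < r / 2 by lra.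
have dS j k : rnorm (('d (q j.+1) x k : R[i]) - 'd (q j) x k) <= 4 * K * rnorm k / r / 2 ^+ j.
  have dE := congr1 (fun h : E -> C => h k) (diffB (dq j.+1 _ xx) (dq j _ xx)).
  have -> : ('d (q j.+1) x k : R[i]) - 'd (q j) x k = 'd (q j.+1 - q j) x k.
    exact: esym dE.
  move=> {dE}.
  have -> : 4 * K * rnorm k / r / 2 ^+ j = 2 * K / 2 ^+ j * rnorm k / (r / 2).
    by field; rewrite ?(gt_eqF r0) ?(gt_eqF (p2 j)).
  apply: (@cauchy_estimate (q j.+1 - q j) x k (r / 2) (2 * K / 2 ^+ j) r20) => y hy.
    exact: differentiableB (dq _ _ hy) (dq _ _ hy).
  have -> : (q j.+1 - q j) y = (q j.+1 y - g y) - (q j y - g y) :> R[i].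
    by rewrite !fctE; ring.
  have := rnormB (q j.+1 y - g y) (q j y - g y).
  have := qg j _ hy; have := qg j.+1 _ hy.
  have : K / 2 ^+ j.+1 <= K / 2 ^+ j.
    by rewrite ler_wpM2l // lef_pV2 ?posrE // ler_eXn2l ?ltr1n.
  lra.
have limT k : {l : R[i] | forall j, rnorm (('d (q j) x k : R[i]) - l) <= 16 * K * rnorm k / r /
    2 ^+ j}.
  apply: cid; have [l hl] := geometric_cvg (fun j => dS j k).
  exists l => j; apply: le_trans (hl j) _; rewrite le_eqVlt; apply/orP; left; apply/eqP.
  by field; rewrite ?(gt_eqF r0) ?(gt_eqF (p2 j)).
pose T k : C := sval (limT k).
have hT j k : rnorm (('d (q j) x k : R[i]) - T k) <= 16 * K * rnorm k / r / 2 ^+ j.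
  exact: (svalP (limT k) j).
have linT : linear T.
  move=> a u w; apply/eqP; rewrite -subr_eq0 -rnorm_eq0 eq_le rnorm_ge0 andbT.
  apply/ler_addgt0Pr => e e0; rewrite add0r.
  pose B := 16 * K * rnorm (a *: u + w) / r + rnorm a * (16 * K * rnorm u / r) + 16 * K * rnorm
      w / r.
  have [j hj] := half_pow_small B e0; apply: le_trans (ltW hj).
  have := hT j (a *: u + w); have := hT j u; have := hT j w.
  rewrite linearD diff_scale.
  set D1 : R[i] := 'd (q j) x u; set D2 : R[i] := 'd (q j) x w => h1 h2 h3.
  have -> : T (a *: u + w) - (a *: T u + T w) =
     a * (D1 - T u) + (D2 - T w) - (a * D1 + D2 - T (a *: u + w)).
    by rewrite /GRing.scale /=; ring.
  apply: le_trans (rnormB _ _) _; apply: le_trans (lerD (rnormD _ _) (lexx _)) _.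
  rewrite rnormM.
  have := ler_wpM2l (rnorm_ge0 a) h2.
  have -> : B / 2 ^+ j = rnorm a * (16 * K * rnorm u / r / 2 ^+ j) + 16 * K * rnorm w / r / 2 ^+ j
     + 16 * K * rnorm (a *: u + w) / r / 2 ^+ j.
    by rewrite /B; field; rewrite ?(gt_eqF r0) ?(gt_eqF (p2 j)).
  lra.
pose TL : {linear E -> C} := HB.pack_for {linear E -> C} T
  (GRing.isLinear.Build R[i] E C *:%R T linT).
have Qdq k : rnorm ('d (q 0) x k) <= Q * rnorm k / (r / 2).
  exact: (@cauchy_estimate (q 0) x k (r / 2) Q r20 (dq 0) (qQ 0)).
have TB k : rnorm (TL k) <= (Q / (r / 2) + 16 * K / r) * rnorm k.
  rewrite -[TL k]/(T k).
  have := rnormB ('d (q 0) x k) ('d (q 0) x k - T k); rewrite subKr.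
  have := hT 0 k; rewrite expr0 divr1; have := Qdq k; lra.
have rem k : rnorm k < r / 2 -> rnorm (g (x + k) - g x - TL k) <= 32 * Q / r ^+ 2 * rnorm k ^+ 2.
  move=> hk; rewrite -[TL k]/(T k); apply/ler_addgt0Pr => e e0.
  have [j hj] := half_pow_small (2 * K + 16 * K * rnorm k / r) e0.
  have xk : rnorm (x + k - x) < r / 2 by rewrite addrC addKr.
  have h0 : rnorm (q j (x + k) - q j x - 'd (q j) x k) <= 32 * Q / r ^+ 2 * rnorm k ^+ 2.
    have -> : 32 * Q / r ^+ 2 * rnorm k ^+ 2 = 8 * Q * rnorm k ^+ 2 / (r / 2) ^+ 2.
      by field; rewrite gt_eqF.
    exact: (@quadratic_remainder (q j) x k (r / 2) Q (dq j) (qQ j) hk).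
  have h1 := qg j _ xk; have h2 := qg j _ xx; have h3 := hT j k.
  move: h0 h3; set D : R[i] := 'd (q j) x k => h0 h3.
  have -> : g (x + k) - g x - T k = (q j (x + k) - q j x - D) + (D - T k)
     + ((q j x - g x) - (q j (x + k) - g (x + k))) by ring.
  apply: le_trans (rnormD _ _) _; apply: le_trans (lerD (rnormD _ _) (rnormB _ _)) _.
  have e1 : (2 * K + 16 * K * rnorm k / r) / 2 ^+ j =
     K / 2 ^+ j + K / 2 ^+ j + 16 * K * rnorm k / r / 2 ^+ j by ring.
  rewrite e1 in hj; lra.
have [] // := @rnorm_differentiable R E C g x TL _ TB.
move=> e e0.
have B0 : 0 <= 32 * Q / r ^+ 2.
  apply: divr_ge0 (sqr_ge0 _); apply: mulr_ge0 => //.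
  by apply: divr_ge0 (ltW r0); apply: mulr_ge0 (rnorm_ge0 _); apply: mulr_ge0.
have B1 : 0 < 32 * Q / r ^+ 2 + 1 by rewrite ltr_wpDl.
exists (Num.min (r / 2) (e / (32 * Q / r ^+ 2 + 1))).
  by rewrite lt_min r20 divr_gt0.
move=> k; rewrite lt_min (ltr_pdivlMr _ _ B1) => /andP[kr ke].
apply: le_trans (rem k kr) _; rewrite expr2 mulrA ler_wpM2r ?rnorm_ge0 //.
by rewrite mulrC; have := rnorm_ge0 k; lra.
Qed.

Lemma near_derive_differentiable f x v : (\near x, differentiable f x) ->
  differentiable (fun y => 'd f y v : C) x.
Proof.
move=> /nbhs_rnormP[d d0 hd].
have xx : rnorm (x - x) < d by rewrite subrr rnorm0.
have /continuous_rnormP/(_ 1 ltr01)[d' d'0 hd'] := differentiable_continuous (hd _ xx).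
apply: (@derive_differentiable f x v (Num.min d d') (rnorm (f x) + 1)).
- by rewrite lt_min d0.
- by move=> y; rewrite lt_min => /andP[/hd].
- move=> y; rewrite lt_min => /andP[_ /hd' h].
  by have := rnormD (f y - f x) (f x); rewrite subrK; lra.
Qed.

End several.

(** * Holomorphic maps between manifolds *)

Section near_diff.
Variables (K : numFieldType) (E F : normedModType K).

Lemma near_differentiable (f g : E -> F) (x : E) : (\near x, f x = g x) ->
  differentiable f x -> differentiable g x /\ 'd g x = 'd f x :> (E -> F).
Proof.
move=> fg df.
have fgx : f x = g x by exact: nbhs_singleton fg.
have gx : g \o shift x = cst (g x) + 'd f x +o_ 0 id.
  apply/eqaddoP => e e0.
  have /eqaddoP/(_ e e0) h := diff_locally df.
  have h2 : \forall y \near (0 : E), f (y + x) = g (y + x).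
    have /(_ _ fg) : (y + x) @[y --> (0 : E)] --> x.
      by rewrite -[X in _ --> X]add0r; apply: cvgD; [exact: cvg_id|exact: cvg_cst].
    by [].
  near=> y.
  have : `|(f \o shift x - (cst (f x) + 'd f x)) y| <= e * `|id y| by near: y.
  rewrite !fctE /= fgx; suff -> : f (y + x) = g (y + x) by [].
  by near: y.
have dg := diff_unique (diff_continuous df) gx; split=> //.
by apply/diff_locallyP; rewrite dg; split=> //; exact: diff_continuous.
Unshelve. all: by end_near. Qed.

End near_diff.

Section holo.
Variables (R : realType).
Implicit Types E : normedModType R[i].

Lemma chart_near E (M : topologicalType) (c : chart E M) x (P : set M) :
  cdom c x -> nbhs x P -> \forall z \near cmap c x, P (cinv c z).
Proof.
move=> cx xP; have cz : (cmap c @` cdom c) (cmap c x) by exists x.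
have := cinv_cts cz; rewrite /prop_for/continuous_at cmapK //; exact.
Qed.

Lemma chart_img_near E (M : topologicalType) (c : chart E M) x : cdom c x ->
  \forall z \near cmap c x, (cmap c @` cdom c) z.
Proof. by move=> cx; apply: open_nbhs_nbhs; split; [exact: cimg_open|exists x]. Qed.

Lemma cdom_near E (M : topologicalType) (c : chart E M) x : cdom c x ->
  \forall y \near x, cdom c y.
Proof. by move=> cx; apply: open_nbhs_nbhs; split => //; exact: cdom_open. Qed.

Lemma holomorphic_at_near E1 E2 (M : complexManifold E1) (N : complexManifold E2)
    (f g : M -> N) x : (\near x, f x = g x) ->
  holomorphic_at f x -> holomorphic_at g x.
Proof.
move=> fg [cf df]; have fgx : f x = g x by exact: nbhs_singleton fg.
split.
  move=> P; rewrite -fgx => /cf /(filterI fg).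
  by apply: filterS => y [] /= ->.
move=> c d cM dN cx; rewrite -fgx => dx.
apply: (near_differentiable _ (df c d cM dN cx dx)).1.
by have := chart_near cx fg; apply: filterS => z /= ->.
Qed.

Lemma holomorphic_at_comp E1 E2 E3 (M : complexManifold E1) (N : complexManifold E2)
    (P : complexManifold E3) (f : M -> N) (g : N -> P) x :
  holomorphic_at f x -> holomorphic_at g (f x) -> holomorphic_at (g \o f) x.
Proof.
move=> [cf df] [cg dg]; split; first exact: continuous_comp.
move=> c e cM eP cx ex; have [d dN dfx] := atlas_cover (f x).
have d1 := df c d cM dN cx dfx; have d2 := dg d e dN eP dfx ex.
have E : cmap d (f x) = (cmap d \o f \o cinv c) (cmap c x) by rewrite /= cmapK.
rewrite E in d2.
apply: (near_differentiable _ (differentiable_comp d1 d2)).1.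
have : \forall y \near x, cdom d (f y) by exact: cf (cdom_near dfx).
move=> /(chart_near cx); apply: filterS => z /= dz.
by rewrite /= cmapK.
Qed.

Lemma holomorphic_at_id E (M : complexManifold E) (x : M) : holomorphic_at id x.
Proof.
split; first exact: cvg_id.
by move=> c d cM dM cx dx; apply: (atlas_compat cM dM); exists x.
Qed.

Lemma holomorphic_at_cst E1 E2 (M : complexManifold E1) (N : complexManifold E2)
    (y : N) (x : M) : holomorphic_at (fun=> y) x.
Proof.
split; first exact: cvg_cst.
by move=> c d _ _ _ _; exact: differentiable_cst.
Qed.

Section prod.
Variables (E1 E2 : normedModType R[i]) (X1 : complexManifold E1) (X2 : complexManifold E2).

Lemma holomorphic_at_pair E (M : complexManifold E) (f : M -> X1) (g : M -> X2) x :
  holomorphic_at f x -> holomorphic_at g x ->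
  holomorphic_at (fun y => (f y, g y) : prod_manifold X1 X2) x.
Proof.
move=> [cf df] [cg dg]; split; first exact: cvg_pair.
move=> c _ cM [[d1 d2] /= [d1X d2X] <-] cx [/= d1x d2x].
exact: (differentiable_pair (df c d1 cM d1X cx d1x) (dg c d2 cM d2X cx d2x)).
Qed.

Lemma holomorphic_at_fst (x : prod_manifold X1 X2) :
  holomorphic_at (fst : prod_manifold X1 X2 -> X1) x.
Proof.
split; first exact: cvg_fst.
move=> _ d [[c1 c2] /= [c1X c2X] <-] dX [/= cx1 cx2] dx.
apply: (@differentiable_comp _ (E1 * E2)%type E1 E1 fst (cmap d \o cinv c1)).
  by apply: linear_differentiable => z; exact: cvg_fst.
by apply: (atlas_compat c1X dX); exists x.1.
Qed.

Lemma holomorphic_at_snd (x : prod_manifold X1 X2) :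
  holomorphic_at (snd : prod_manifold X1 X2 -> X2) x.
Proof.
split; first exact: cvg_snd.
move=> _ d [[c1 c2] /= [c1X c2X] <-] dX [/= cx1 cx2] dx.
apply: (@differentiable_comp _ (E1 * E2)%type E2 E2 snd (cmap d \o cinv c2)).
  by apply: linear_differentiable => z; exact: cvg_snd.
by apply: (atlas_compat c2X dX); exists x.2.
Qed.

End prod.

Section plane.
Local Notation C := (R[i])^o.

Lemma holomorphic_at_plane (f : C -> C) (z : C) : differentiable f z ->
  holomorphic_at (f : plane R -> plane R) z.
Proof.
move=> df; split; first exact: differentiable_continuous df.
by move=> c d -> -> _ _.
Qed.

Lemma holomorphic_at_to_plane E (M : complexManifold E) (f : M -> C) x :
  (forall c, atlas M c -> cdom c x -> differentiable (f \o cinv c) (cmap c x)) ->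
  holomorphic_at (f : M -> plane R) x.
Proof.
move=> df; split; last by move=> c d cM -> cx _; exact: df.
have [c cM cx] := atlas_cover x.
have cf := differentiable_continuous (df c cM cx).
have : {for x, continuous ((f \o cinv c) \o cmap c)}.
  by apply: continuous_comp; [exact: cmap_cts|exact: cf].
move=> h P; have := h P; rewrite /= cmapK // => h' /h' /(filterI (cdom_near cx)).
by apply: filterS => y [cy] /=; rewrite cmapK.
Qed.

Lemma holomorphic_at_from_plane E (M : complexManifold E) (f : M -> plane R) c x :
  holomorphic_at f x -> atlas M c -> cdom c x ->
  differentiable ((f : M -> C) \o cinv c) (cmap c x).
Proof. by move=> [_ df] cM cx; exact: (df c (idchart R) cM erefl cx I). Qed.

End plane.

Lemma holomorphic_on_open E1 E2 (M : complexManifold E1) (N : complexManifold E2)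
    (A : set M) (f : M -> N) : open A -> holomorphic_on A f ->
  forall x, A x -> holomorphic_at f x.
Proof.
move=> oA hf x Ax; have [W [g [oW Wx hg gf]]] := hf x Ax.
apply: holomorphic_at_near (hg x Wx).
have : \forall y \near x, A y /\ W y.
  by apply: filterI; apply: open_nbhs_nbhs.
by apply: filterS => y [Ay Wy]; exact: gf.
Qed.

Lemma holomorphic_onW E1 E2 (M : complexManifold E1) (N : complexManifold E2)
    (A B : set M) (f : M -> N) : open B -> A `<=` B ->
  (forall x, B x -> holomorphic_at f x) -> holomorphic_on A f.
Proof. by move=> oB AB hf x Ax; exists B, f; split => //; exact: AB. Qed.

Lemma chart_img_open E (M : topologicalType) (c : chart E M) (V : set M) :
  open V -> open (cmap c @` (cdom c `&` V)).
Proof.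
move=> oV; rewrite openE => _ [x [cx Vx] <-].
suff : \forall z \near cmap c x, (cmap c @` (cdom c `&` V)) z by [].
have xV : \forall y \near x, V y by exact: (open_nbhs_nbhs (conj oV Vx)).
apply: filterS2 (chart_img_near cx) (chart_near cx xV) => _ [y cy <-].
by rewrite cmapK // => Vy; exists y.
Qed.

Lemma holomorphic_chart_near E1 E2 (M : complexManifold E1) (N : complexManifold E2)
    (f : M -> N) x c d : (\near x, holomorphic_at f x) -> atlas M c -> atlas N d ->
  cdom c x -> cdom d (f x) ->
  \forall z \near cmap c x, differentiable (cmap d \o f \o cinv c) z.
Proof.
move=> hf cM dN cx dx.
have [cf _] := nbhs_singleton hf.
have : \forall y \near x, cdom c y /\ cdom d (f y) /\ holomorphic_at f y.
  apply: filterI; first exact: cdom_near.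
  by apply: filterI => //; exact: cf (cdom_near dx).
move=> /(chart_near cx); apply: filter_app.
apply: filterS (chart_img_near cx) => _ [y cy <-] /=.
by rewrite cmapK // => -[_ [dy [_ dfy]]]; exact: dfy.
Qed.

End holo.

(** * Biholomorphisms onto open sets have open domains *)

Section rowvectors.
Variable (R : realType).
Local Notation C := (R[i])^o.

Lemma rnorm_coord m (w : 'rV[R[i]]_m) j : rnorm (w 0 j : R[i]) <= rnorm w.
Proof.
apply/ler_addgt0Pr => e e0.
have : @ball _ ('rV[R[i]]_m : normedModType R[i]) 0 (rnorm w + e)%:C%C w.
  by rewrite -ball_normE /ball_ /= sub0r normrN rnormE ltcR ltrDl.
move=> [_ /(_ 0 j)]; rewrite mxE -ball_normE /ball_ /= sub0r normrN rnormE ltcR.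
exact: ltW.
Qed.

Lemma rnorm_row_le m (w : 'rV[R[i]]_m) (k : R) : 0 <= k ->
  (forall j, rnorm (w 0 j : R[i]) <= k) -> rnorm w <= k.
Proof.
move=> k0 wk; rewrite -lecR -rnormE [leLHS]/Num.Def.normr /=.
have [->|w0] := eqVneq (mx_norm w) 0; first by rewrite (_ : 0 = 0%:C%C) // lecR.
have [[i j] /= ->] := mx_norm_neq0 w0.
by rewrite ord1 rnormE lecR.
Qed.

(** [K = H - id] has derivative 0 at [w0], so near [w0] it satisfies
    [|K (w + k) - K w| <= |k| / 2].  For [k = K w] the point [w + k = H w] is a zero
    of [K], whence [|K w| <= |K w| / 2]. *)
Lemma near_retraction_id m (H : 'rV[R[i]]_m -> 'rV[R[i]]_m) w0 :
  (\near w0, differentiable H w0) -> (forall k, 'd H w0 k = k) -> H w0 = w0 ->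
  (\near w0, H (H w0) = H w0) -> \near w0, H w0 = w0.
Proof.
move=> /nbhs_rnormP[r r0 hd] dH0 Hw0 /nbhs_rnormP[r1 r10 HH].
have ww : rnorm (w0 - w0) < r by rewrite subrr rnorm0.
pose K : 'rV[R[i]]_m -> 'rV[R[i]]_m := H - id.
have KE w : K w = H w - w by [].
have K0 : K w0 = 0 by rewrite KE Hw0 subrr.
have dK w : rnorm (w - w0) < r -> differentiable K w.
  by move=> wr; apply: differentiableB => //; exact: hd.
have dK0 k : 'd K w0 k = 0.
  have id_diff : differentiable (@id 'rV[R[i]]_m) w0 by have [] := is_diff_id w0.
  have := congr1 (fun h : 'rV[R[i]]_m -> 'rV[R[i]]_m => h k)
    (diffB (hd _ ww) id_diff).
  have did : 'd id w0 k = k by rewrite diff_val.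
  rewrite -/K.
  have e2 : ('d H w0 \- 'd id w0) k = k - k := congr2 (fun a b => a - b) (dH0 k) did.
  by move=> e; rewrite e e2 subrr.
pose E : normedModType R[i] := 'rV[R[i]]_m.
have cK : {for (w0 : E), continuous (K : E -> E)} := differentiable_continuous (dK _ ww).
have /continuous_rnormP/(_ _ ltr01)[r2 r20 K1] := cK.
pose q := Num.min r r2.
have q0 : 0 < q by rewrite lt_min r0.
pose f j w : C := K w 0 j.
have df j w : rnorm (w - w0) < q -> differentiable (f j) w.
  rewrite lt_min => /andP[wr _].
  apply: (@differentiable_comp _ _ _ C K (fun v => v 0 j : C)); first exact: dK.
  exact: differentiable_coord.
have fM j w : rnorm (w - w0) < q -> rnorm (f j w) <= 1.
  rewrite lt_min => /andP[_ /K1]; rewrite K0 subr0 => /ltW.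
  by apply: le_trans; exact: rnorm_coord.
have df0 j k : 'd (f j) w0 k = 0.
  have -> : f j = (fun v : 'rV[R[i]]_m => v 0 j : C) \o K by [].
  rewrite diff_comp; [|exact: dK|exact: differentiable_coord].
  by rewrite /= dK0 linear0.
pose d := Num.min (q / 2) (q ^+ 2 / 48).
have d0 : 0 < d by rewrite lt_min !divr_gt0 ?exprn_gt0.
have dq : d <= q / 2 by rewrite ge_min lexx.
have dq2 : d <= q ^+ 2 / 48 by rewrite ge_min lexx orbT.
have contr y k : rnorm (y - w0) < d -> rnorm k < d -> rnorm (K (y + k) - K y) <= rnorm k / 2.
  move=> yd kd; apply: rnorm_row_le; first by rewrite divr_ge0 ?rnorm_ge0.
  move=> j; have -> : (K (y + k) - K y) 0 j = f j (y + k) - f j y by rewrite /f !mxE.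
  have h1 := second_difference (df j) (fM j) (lt_le_trans yd dq) (lt_le_trans kd dq).
  have kq : rnorm k < q by lra.
  have h2 := quadratic_remainder (df j) (fM j) kq.
  move: h1 h2; rewrite df0 subr0 [w0 + (y - w0)]addrC subrK => h1 h2.
  have -> : f j (y + k) - f j y = (f j (y + k) - f j y - (f j (w0 + k) - f j w0))
    + (f j (w0 + k) - f j w0) by rewrite subrK.
  apply: le_trans (rnormD _ _) _; apply: le_trans (lerD h1 h2) _.
  have q2 : 0 < q ^+ 2 by rewrite exprn_gt0.
  have -> : 16 * 1 * rnorm (y - w0) * rnorm k / q ^+ 2 + 8 * 1 * rnorm k ^+ 2 / q ^+ 2 =
     rnorm k * ((16 * rnorm (y - w0) + 8 * rnorm k) / q ^+ 2) by field; rewrite gt_eqF.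
  rewrite ler_wpM2l ?rnorm_ge0 // ler_pdivrMr //; lra.
have /continuous_rnormP/(_ _ d0)[r3 r30 K3] := cK.
apply/nbhs_rnormP; exists (Num.min (Num.min r1 d) r3).
  by rewrite lt_min r30 andbT lt_min r10.
move=> w; rewrite lt_min => /andP[+ w3]; rewrite lt_min => /andP[w1 w2].
have kd := K3 _ w3; rewrite K0 subr0 in kd.
have := contr w (K w) w2 kd; rewrite KE [w + _]addrC subrK -KE.
have -> : K (H w) = 0 by rewrite KE HH // subrr.
rewrite sub0r rnormN => h; apply/eqP; rewrite -subr_eq0 -KE -rnorm_eq0.
by have := rnorm_ge0 (K w); rewrite eq_le rnorm_ge0 andbT; lra.
Qed.

(** Both spaces have dimension [n.+1]; the isomorphism [J] reduces the claim to
    square matrices. *)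
Lemma linear_right_inverse_left n (A : {linear 'rV[R[i]]_n.+1 -> ('rV[R[i]]_n * C)%type})
    (B : {linear ('rV[R[i]]_n * C)%type -> 'rV[R[i]]_n.+1}) :
  (forall u, A (B u) = u) -> forall w, B (A w) = w.
Proof.
move=> AB.
pose J (u : 'rV[R[i]]_n * C) : 'rV[R[i]]_(1 + n) := row_mx (u.2%:M) u.1.
pose J' (w : 'rV[R[i]]_(1 + n)) : 'rV[R[i]]_n * C := (rsubmx w, lsubmx w 0 0).
have J'J u : J' (J u) = u.
  by rewrite /J /J' row_mxKl row_mxKr mxE eqxx mulr1n; case: u.
have JJ' w : J (J' w) = w.
  by rewrite /J /J' /= -[X in row_mx X](mx11_scalar (lsubmx w)) hsubmxK.
have linJ : linear J.
  move=> a u v; rewrite /J /= scale_row_mx add_row_mx; congr row_mx.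
  by rewrite -[a *: u.2 + v.2]/(a * u.2 + v.2) raddfD /= scale_scalar_mx.
have linJ' : linear J'.
  by move=> a u v; rewrite /J' !linearP !mxE.
pose a : {linear 'rV[R[i]]_n.+1 -> 'rV[R[i]]_(1 + n)} := HB.pack_for {linear 'rV[R[i]]_n.+1 ->
    'rV[R[i]]_(1 + n)} (J \o A)
  (GRing.isLinear.Build R[i] 'rV[R[i]]_n.+1 'rV[R[i]]_(1 + n) *:%R (J \o A)
    (fun k u v => etrans (congr1 J (linearP A k u v)) (linJ k (A u) (A v)))).
pose b : {linear 'rV[R[i]]_(1 + n) -> 'rV[R[i]]_n.+1} := HB.pack_for {linear 'rV[R[i]]_(1 + n)
    -> 'rV[R[i]]_n.+1} (B \o J')
  (GRing.isLinear.Build R[i] 'rV[R[i]]_(1 + n) 'rV[R[i]]_n.+1 *:%R (B \o J')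
    (fun k u v => etrans (congr1 B (linJ' k u v)) (linearP B k (J' u) (J' v)))).
have ba : lin1_mx b *m lin1_mx a = 1%:M.
  apply/row_matrixP => i; rewrite row1 rowE mulmxA !mul_rV_lin1 /=.
  by rewrite AB JJ'.
have ab := mulmx1C ba.
move=> w; have := mulmx1 w; rewrite -ab mulmxA !mul_rV_lin1 /= J'J.
exact.
Qed.

End rowvectors.

Section openness.
Variables (R : realType) (n : nat).
Variables (X : complexManifold 'rV[R[i]]_n) (M : complexManifold 'rV[R[i]]_n.+1).
Local Notation C := (R[i])^o.

(** Holomorphy of [t] on [A] only provides an extension [g] of [t] near each point of
    [A].  In charts, [s \o g] is idempotent, and its derivative is the identity,
    because [g \o s] is the identity and the dimensions agree.  So [s \o g] is the
    identity near each point of [A], and its values lie in [A]. *)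
Lemma biholomorphism_open (t : M -> prod_manifold X (plane R)) s A B :
  open B -> biholomorphism t s A B -> open A.
Proof.
move=> oB [ht hs tAB sBA [ts st]].
rewrite openE => v0 Av0.
have hs_at := holomorphic_on_open oB hs.
have tF : Filter (nbhs (t v0)) by exact: (@nbhs_filter (prod_manifold X (plane R))).
have Bt : B (t v0) by apply: tAB; exists v0.
have [W [g [oW Wv0 hg gt]]] := ht v0 Av0.
have [c cM cv] := atlas_cover v0.
have [d dN da] := atlas_cover (t v0).
have gv0 : g v0 = t v0 by exact: gt.
have sv0 : s (t v0) = v0 by exact: ts.
have near_g : \forall v \near v0, holomorphic_at g v.
  by apply: filterS (open_nbhs_nbhs (conj oW Wv0)) => v; exact: hg.
have near_s : \forall b \near (t v0), holomorphic_at s b.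
  by apply: filterS (open_nbhs_nbhs (conj oB Bt)) => b; exact: hs_at.
have cg : {for v0, continuous g} by case: (hg _ Wv0).
have cs : {for t v0, continuous s} by case: (hs_at _ Bt).
pose Gm := cmap d \o g \o cinv c; pose S := cmap c \o s \o cinv d.
pose w0 := cmap c v0; pose z0 := cmap d (t v0).
have Gw0 : Gm w0 = z0 by rewrite /Gm /= cmapK // gv0.
have Sz0 : S z0 = w0 by rewrite /S /= cmapK // sv0.
have dg0 : cdom d (g v0) by rewrite gv0.
have dG : \forall w \near w0, differentiable Gm w.
  exact: holomorphic_chart_near near_g cM dN cv dg0.
have cs0 : cdom c (s (t v0)) by rewrite sv0.
have dS : \forall z \near z0, differentiable S z.
  exact: holomorphic_chart_near near_s dN cM da cs0.
have nB : \forall b \near t v0, [/\ B b, cdom d b, W (s b) & cdom c (s b)].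
  have h0 : \forall v \near s (t v0), W v /\ cdom c v.
    rewrite sv0; apply: filterI; last exact: cdom_near.
    exact: open_nbhs_nbhs.
  have h2 : \forall b \near t v0, B b by exact: open_nbhs_nbhs.
  have h3 : \forall b \near t v0, cdom d b by exact: cdom_near.
  have h1 : \forall b \near t v0, W (s b) /\ cdom c (s b) by exact: cs _ h0.
  by apply: filterS (filterI h1 (filterI h2 h3)) => b [[? ?] [? ?]].
have good : \forall v \near v0, [/\ cdom c v, cdom d (g v), B (g v), W (s (g v)) & cdom c (s (g
    v))].
  have nB' := nB; rewrite -gv0 in nB'.
  have h : \forall v \near v0, [/\ B (g v), cdom d (g v), W (s (g v)) & cdom c (s (g v))].
    exact: cg _ nB'.
  by apply: filterS2 (cdom_near cv) h => v ? [? ? ? ?].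
have sA v : B (g v) -> A (s (g v)) by move=> Bg; apply: sBA; exists (g v).
have gs v : B (g v) -> W (s (g v)) -> g (s (g v)) = g v.
  by move=> Bg Wg; rewrite gt //; [exact: st|exact: sA].
pose H := S \o Gm.
have Hw0 : H w0 = w0 by rewrite /H /= Gw0.
have HE v : [/\ cdom c v, cdom d (g v), B (g v), W (s (g v)) & cdom c (s (g v))] ->
    H (cmap c v) = cmap c (s (g v)).
  by move=> [h1 h2 h3 h4 h5]; rewrite /H /S /Gm /= !cmapK.
have HH : \forall w \near w0, H (H w) = H w.
  have := chart_near cv good; apply: filterS2 (chart_img_near cv).
  move=> _ [v vc <-]; rewrite cmapK // => h; rewrite (HE v h).
  case: h => h1 h2 h3 h4 h5.
  by rewrite HE gs.
have dH : \forall w \near w0, differentiable H w.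
  have cG : {for w0, continuous Gm} := differentiable_continuous (nbhs_singleton dG).
  have dS' := dS; rewrite -Gw0 in dS'.
  have h : \forall w \near w0, differentiable S (Gm w) by exact: cG _ dS'.
  by apply: filterS2 dG h => w; exact: differentiable_comp.
have GS : \forall z \near z0, Gm (S z) = z.
  have := chart_near da nB; apply: filterS2 (chart_img_near da).
  move=> _ [b bd <-]; rewrite cmapK // => -[h1 h2 h3 h4].
  rewrite /Gm /S /= cmapK // cmapK // gt //; first by rewrite st.
  by apply: sBA; exists b.
have dSz0 := nbhs_singleton dS; have dGw0 := nbhs_singleton dG.
have dGS u : 'd Gm w0 ('d S z0 u) = u.
  have dGS0 : differentiable Gm (S z0) by rewrite Sz0.
  have := diff_comp dSz0 dGS0; rewrite Sz0.
  have /near_differentiable : \forall z \near z0, id z = (Gm \o S) z.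
    by apply: filterS GS => z /= ->.
  have id_diff : differentiable id z0 by have [] := is_diff_id z0.
  move=> /(_ id_diff)[_ ->] e.
  have := congr1 (fun h => h u) e; rewrite /= => <-.
  by rewrite diff_val.
have dH0 k : 'd H w0 k = k.
  have dSG : differentiable S (Gm w0) by rewrite Gw0.
  rewrite /H (diff_comp dGw0 dSG) Gw0 /=.
  exact: (linear_right_inverse_left dGS).
have Hid := near_retraction_id dH dH0 Hw0 HH.
have Hid' : \forall v \near v0, H (cmap c v) = cmap c v by exact: cmap_cts cv _ Hid.
suff : \forall v \near v0, A v by [].
apply: filterS2 good Hid' => v h; rewrite (HE v h).
case: h => h1 h2 h3 h4 h5 e.
have <- : s (g v) = v by rewrite -[LHS](cmapK h5) e cmapK.
exact: sA.
Qed.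

End openness.

(** * Metrics and trivializations of line bundles *)

(* inclusion of the fibres, rather than of sets *)
Local Notation incl := Defs.incl.

Section hermitian.
Variables (R : realType) (n : nat) (X : complexManifold 'rV[R[i]]_n).
Variables (L : line_bundle X) (h : hermitian_metric L).
Local Notation C := (R[i])^o.

Lemma hform0l x (w : fiber L x) : hform h 0 w = 0.
Proof.
have := hform_linear h 1 0 0 w; rewrite scaler0 addr0 mul1r => e.
by apply: (addrI (hform h 0 w)); rewrite addr0 -e.
Qed.

Lemma hformZl x (a : R[i]) (u w : fiber L x) : hform h (a *: u) w = a * hform h u w.
Proof. by rewrite -[a *: u]addr0 hform_linear hform0l addr0. Qed.

Lemma sqnormZ x (a : R[i]) (u : fiber L x) :
  sqnorm h (a *: u) = rnorm a ^+ 2 * sqnorm h u.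
Proof.
rewrite /sqnorm hformZl hform_conj hformZl rmorphM /= -(hform_conj h u u) mulrA.
have -> : a * a^*%R = (rnorm a ^+ 2)%:C%C.
  by rewrite rmorphXn /= -rnormE sqr_normc.
by case: (hform h u u) => p q /=; rewrite mul0r subr0.
Qed.

Lemma sqnorm_gt0 x (u : fiber L x) : u != 0 -> 0 < sqnorm h u.
Proof. by move=> /(hform_pos h); rewrite ltcE /= => /andP[]. Qed.

Lemma sqnorm0 x : sqnorm h (0 : fiber L x) = 0.
Proof. by rewrite /sqnorm hform0l. Qed.

Lemma sqnorm_ge0 x (u : fiber L x) : 0 <= sqnorm h u.
Proof. by have [->|/sqnorm_gt0/ltW //] := eqVneq u 0; rewrite sqnorm0. Qed.

Lemma fiber_of (v : tot L) x : proj L v = x -> exists u : fiber L x, incl L u = v.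
Proof. by move=> <-; exists (vec L v); exact: vecK. Qed.

Lemma metric_norm_incl x (u : fiber L x) : metric_norm h (incl L u) = Num.sqrt (sqnorm h u).
Proof.
rewrite /metric_norm; congr Num.sqrt.
move: (vec L (incl L u)) (vecK (incl L u)); rewrite proj_incl => w /incl_inj ->.
by [].
Qed.

Lemma sqnorm_frame_continuous V s x : local_frame (L := L) V s -> V x ->
  {for x, continuous (fun y => sqnorm h (s y))}.
Proof.
move=> Vs Vx; have [c cX cx] := atlas_cover x.
have [cz _] := hform_smooth h Vs cX 0.
have cVx : (cmap c @` (cdom c `&` V)) (cmap c x) by exists x.
have ch := cz _ cVx.
have : {for x, continuous (((fun y => sqnorm h (s y)) \o cinv c) \o cmap c)}.
  by apply: continuous_comp; [exact: cmap_cts|exact: ch].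
move=> k P; have := k P; rewrite /= cmapK // => k' /k' /(filterI (cdom_near cx)).
by apply: filterS => y [cy] /=; rewrite cmapK.
Qed.

End hermitian.

Section trivialization.
Variables (R : realType) (n : nat) (X : complexManifold 'rV[R[i]]_n).
Variables (L : line_bundle X) (V : set X).
Variables (t : tot L -> prod_manifold X (plane R)) (s : prod_manifold X (plane R) -> tot L).
Local Notation C := (R[i])^o.

(** The properties of the maps provided by [loc_triv]. *)
Definition trivializes :=
  [/\ open V, biholomorphism t s (proj L @^-1` V) (V `*` [set: plane R]),
      forall v, V (proj L v) -> (t v).1 = proj L v
    & forall y, V y -> linear (fun u : fiber L y => (t (incl L u)).2 : C)].

Hypothesis triv : trivializes.

Lemma triv_open : open V. Proof. by case: triv. Qed.

Lemma triv_dom_open : open (V `*` [set: plane R]).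
Proof. by apply: open_setX; [exact: triv_open|exact: openT]. Qed.

(** The projection is not assumed to be continuous; see [biholomorphism_open]. *)
Lemma triv_preimage_open : open (proj L @^-1` V).
Proof.
by case: triv => _ ts _ _; exact: biholomorphism_open triv_dom_open ts.
Qed.

Lemma triv_holomorphic v : V (proj L v) -> holomorphic_at t v.
Proof.
by case: triv => _ [ht _ _ _ _] _ _; exact: (holomorphic_on_open triv_preimage_open ht).
Qed.

Lemma triv_inv_holomorphic b : V b.1 -> holomorphic_at s b.
Proof.
case: triv => _ [_ hs _ _ _] _ _ Vb.
apply: (@holomorphic_on_open _ _ _ (prod_manifold X (plane R)) (tot L) _ s
  triv_dom_open hs).
by split.
Qed.

Lemma trivK v : V (proj L v) -> s (t v) = v.
Proof. by case: triv => _ [_ _ _ _ [ts _]] _ _; exact: ts. Qed.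

Lemma triv_invK x w : V x -> t (s (x, w)) = (x, w).
Proof. by case: triv => _ [_ _ _ _ [_ st]] _ _ Vx; exact: st. Qed.

Lemma triv_inv_in x w : V x -> V (proj L (s (x, w))).
Proof.
by case: triv => _ [_ _ _ sB _] _ _ Vx; apply: sB; exists (x, w).
Qed.

Lemma triv_fst v : V (proj L v) -> (t v).1 = proj L v.
Proof. by case: triv => _ _ tp _; exact: tp. Qed.

Lemma triv_inv_proj x w : V x -> proj L (s (x, w)) = x.
Proof. by move=> Vx; rewrite -(triv_fst (triv_inv_in w Vx)) triv_invK. Qed.

Lemma triv_linear x (a : R[i]) (u v : fiber L x) : V x ->
  (t (incl L (a *: u + v))).2 = a * (t (incl L u)).2 + (t (incl L v)).2 :> R[i].
Proof. by case: triv => _ _ _ lin Vx; exact: lin. Qed.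

Lemma triv_zero x : V x -> (t (incl L (0 : fiber L x))).2 = 0 :> R[i].
Proof.
move=> Vx; have := triv_linear 1 0 0 Vx; rewrite scaler0 addr0 mul1r => e.
by apply: (addrI ((t (incl L (0 : fiber L x))).2 : R[i])); rewrite addr0 -e.
Qed.

Lemma trivZ x (a : R[i]) (u : fiber L x) : V x ->
  (t (incl L (a *: u))).2 = a * (t (incl L u)).2 :> R[i].
Proof. by move=> Vx; rewrite -[a *: u]addr0 triv_linear // triv_zero // addr0. Qed.

Lemma triv_frame_exists : exists e : forall x, fiber L x,
  forall x, V x -> incl L (e x) = s (x, 1).
Proof.
suff f x : {u : fiber L x | V x -> incl L u = s (x, 1)}.
  by exists (fun x => sval (f x)) => x; exact: (svalP (f x)).
apply: cid; have [Vx|nVx] := pselect (V x); last by exists 0.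
by have [u hu] := fiber_of (triv_inv_proj 1 Vx); exists u.
Qed.

Variable e : forall x, fiber L x.
Hypothesis eE : forall x, V x -> incl L (e x) = s (x, 1).

Lemma triv_inv_frame x (w : R[i]) : V x -> incl L (w *: e x) = s (x, w).
Proof.
move=> Vx.
have Vp : V (proj L (incl L (w *: e x))) by rewrite proj_incl.
rewrite -(trivK Vp); congr s; rewrite (surjective_pairing (t _)).
congr pair; first by rewrite triv_fst // proj_incl.
by rewrite trivZ // eE // triv_invK // mulr1.
Qed.

Lemma triv_frame_coord x (u : fiber L x) : V x -> u = ((t (incl L u)).2 : R[i]) *: e x.
Proof.
move=> Vx; apply: incl_inj; rewrite triv_inv_frame //.
have Vp : V (proj L (incl L u)) by rewrite proj_incl.
by rewrite -[LHS](trivK Vp) [t _ in LHS]surjective_pairing triv_fst // proj_incl.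
Qed.

Lemma triv_frame_neq0 x : V x -> e x != 0.
Proof.
move=> Vx; apply/eqP => e0; have := triv_zero Vx.
by rewrite -e0 eE // triv_invK //= => /eqP; rewrite oner_eq0.
Qed.

Lemma triv_local_frame (W : set X) (g : X -> R[i]) : open W -> W `<=` V ->
  (forall x, W x -> holomorphic_at (g : X -> plane R) x) ->
  (forall x, W x -> g x != 0) ->
  local_frame (L := L) W (fun x => g x *: e x).
Proof.
move=> oW WV hg g0; split=> //; last first.
  by move=> x Wx; rewrite scaler_eq0 negb_or g0 //; exact/triv_frame_neq0/WV.
move=> x Wx; exists W, (fun y => s (y, g y)); split=> // y Wy; last first.
  by move=> _; rewrite triv_inv_frame //; exact: WV.
apply: (@holomorphic_at_comp _ _ _ _ X (prod_manifold X (plane R)) (tot L)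
  (fun y => (y, g y)) s); last by apply: triv_inv_holomorphic; exact: WV.
by apply: holomorphic_at_pair; [exact: holomorphic_at_id|exact: hg].
Qed.

Lemma triv_frame_local_frame : local_frame (L := L) V e.
Proof.
have -> : e = fun x => (1 : R[i]) *: e x by apply: functional_extensionality_dep => x; rewrite
    scale1r.
apply: triv_local_frame => // [|x _|x _]; [exact: triv_open| |exact: oner_neq0].
exact: (@holomorphic_at_cst _ _ _ X (plane R) (1 : R[i])).
Qed.

Lemma proj_holomorphic_at v : V (proj L v) -> holomorphic_at (proj L) v.
Proof.
move=> Vv; apply: (@holomorphic_at_near _ _ _ _ _ (fst \o t)).
  by apply: filterS (open_nbhs_nbhs (conj triv_preimage_open Vv)) => w Vw; exact: triv_fst.
apply: holomorphic_at_comp; first exact: triv_holomorphic.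
exact: holomorphic_at_fst.
Qed.

Variable h : hermitian_metric L.

Lemma metric_norm_triv v : V (proj L v) ->
  metric_norm h v = rnorm ((t v).2 : R[i]) * Num.sqrt (sqnorm h (e (proj L v))).
Proof.
move=> Vv; have := triv_frame_coord (vec L v) Vv; rewrite vecK => ev.
rewrite -{1}(vecK v) metric_norm_incl ev sqnormZ sqrtrM ?sqr_ge0 //.
by rewrite sqrtr_sqr ger0_norm ?rnorm_ge0.
Qed.

Lemma metric_norm_continuous v : V (proj L v) -> {for v, continuous (metric_norm h)}.
Proof.
move=> Vv.
have [ct _] := triv_holomorphic Vv.
have [cp _] := proj_holomorphic_at Vv.
have cH := @sqnorm_frame_continuous _ _ _ _ h _ _ _ triv_frame_local_frame Vv.
have c1 : {for v, continuous (fun v => rnorm ((t v).2 : C))}.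
  apply: (@continuous_comp (tot L) (prod_manifold X (plane R)) R t (fun b => rnorm (b.2 : C)))
      => //.
  apply: (@continuous_comp (prod_manifold X (plane R)) C R snd (fun b : C => rnorm b)); first
      exact: cvg_snd.
  exact: rnorm_continuous.
have c2 : {for v, continuous (fun v => Num.sqrt (sqnorm h (e (proj L v))))}.
  apply: (@continuous_comp (tot L) X R (proj L) (fun x => Num.sqrt (sqnorm h (e x)))) => //.
  apply: (@continuous_comp X R R (fun x => sqnorm h (e x)) Num.sqrt) => //.
  exact: realfun.sqrt_continuous.
have c3 := continuousM c1 c2.
move=> P; rewrite (metric_norm_triv Vv) => /c3.
apply: filterS2 (open_nbhs_nbhs (conj triv_preimage_open Vv)) => w Vw /=.
by rewrite metric_norm_triv.
Qed.

End trivialization.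

(** * The disc bundle *)

Section bundle.
Variables (R : realType) (n : nat) (X : complexManifold 'rV[R[i]]_n).
Variables (L : line_bundle X).
Local Notation C := (R[i])^o.

(** A holomorphic section [sg] through [v] gives a right inverse of the derivative
    of the projection. *)
Lemma proj_submersive V t s v : trivializes (L := L) V t s -> V (proj L v) ->
  submersive_at (proj L) v.
Proof.
move=> triv Vv c d cM dX cv dv.
pose sg (x : X) : tot L := s (x, (t v).2).
have sgv : sg (proj L v) = v.
  by rewrite /sg -(triv_fst triv Vv) -surjective_pairing (trivK triv Vv).
have hsg : holomorphic_at sg (proj L v).
  apply: (@holomorphic_at_comp _ _ _ _ X (prod_manifold X (plane R)) (tot L)
    (fun y => (y, (t v).2)) s); last exact: (triv_inv_holomorphic triv).
  by apply: holomorphic_at_pair; [exact: holomorphic_at_id|exact: holomorphic_at_cst].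
have csg : cdom c (sg (proj L v)) by rewrite sgv.
have dS := hsg.2 d c dX cM dv csg.
have dP := (proj_holomorphic_at triv Vv).2 c d cM dX cv dv.
set P := cmap d \o _ \o _ in dP *; set S := cmap c \o _ \o _ in dS.
have Sd : S (cmap d (proj L v)) = cmap c v by rewrite /S /= cmapK // sgv.
have PS : \forall z \near cmap d (proj L v), id z = (P \o S) z.
  have h0 : \forall w \near sg (proj L v), cdom c w by exact: cdom_near.
  have h1 : \forall x \near proj L v, cdom c (sg x) by exact: hsg.1 _ h0.
  have h2 : \forall x \near proj L v, V x.
    by exact: (open_nbhs_nbhs (conj (triv_open triv) Vv)).
  apply: filterS2 (chart_img_near dv) (chart_near dv (filterI h1 h2)).
  move=> _ [x dx <-]; rewrite cmapK // => -[cx Vx].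
  by rewrite /P /S /= (cmapK dx) (cmapK cx) (triv_inv_proj triv).
move=> w; exists ('d S (cmap d (proj L v)) w).
have id_diff : differentiable (@id 'rV[R[i]]_n) (cmap d (proj L v)).
  by have [] := is_diff_id (cmap d (proj L v)).
have [_ e] := near_differentiable PS id_diff.
have dP' := dP; rewrite -Sd in dP'.
have e1 := congr1 (fun h : 'rV[R[i]]_n -> 'rV[R[i]]_n => h w) (diff_comp dS dP').
have e2 := congr1 (fun h : 'rV[R[i]]_n -> 'rV[R[i]]_n => h w) e.
rewrite -Sd; apply: etrans (esym e1) _; apply: etrans e2 _.
by rewrite diff_val.
Qed.

Lemma trivialization_exists (x : X) : exists V t s, trivializes (L := L) V t s /\ V x.
Proof.
have [V [t [s [oV Vx ts tp lin]]]] := loc_triv L x.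
by exists V, t, s; split.
Qed.

Variables (h : hermitian_metric L) (eps : R).
Hypothesis eps0 : 0 < eps.

Let U : set (tot L) := [set v | metric_norm h v < eps].

Lemma disc_bundle_open : open U.
Proof.
rewrite openE => v Uv.
have [V [t [s [triv Vx]]]] := trivialization_exists (proj L v).
have [e eE] := triv_frame_exists triv.
have cm := metric_norm_continuous triv eE (h := h) Vx.
suff : \forall w \near v, metric_norm h w < eps by [].
have hn : \forall y \near metric_norm h v, y < eps.
  by apply: open_nbhs_nbhs; split; [exact: open_lt|exact: Uv].
exact: cm _ hn.
Qed.

Lemma disc_bundle_submersion : holomorphic_submersion U (proj L).
Proof.
split; first exact: disc_bundle_open.
  apply: (holomorphic_onW disc_bundle_open) => // v _.
  have [V [t [s [triv Vx]]]] := trivialization_exists (proj L v).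
  exact: (proj_holomorphic_at triv Vx).
move=> v _; have [V [t [s [triv Vx]]]] := trivialization_exists (proj L v).
exact: (proj_submersive triv Vx).
Qed.

Lemma disc_bundle_surjective : proj L @` U = [set: X].
Proof.
apply/seteqP; split=> // x _; exists (incl L (0 : fiber L x)); last exact: proj_incl.
by rewrite /U /= metric_norm_incl sqnorm0 sqrtr0.
Qed.

Lemma metric_norm_triv_inv V t s (e : forall x, fiber L x) x (w : R[i]) : trivializes (L := L)
    V t s ->
  (forall x, V x -> incl L (e x) = s (x, 1)) -> V x ->
  metric_norm h (s (x, w)) = rnorm w * Num.sqrt (sqnorm h (e x)).
Proof.
move=> triv eE Vx; rewrite (metric_norm_triv triv eE); last exact: (triv_inv_in triv).
by rewrite (triv_invK triv) // (triv_inv_proj triv).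
Qed.

Lemma holomorphic_at_scale (k : R[i]) (z : R[i]) :
  holomorphic_at ((fun w : C => w * k) : plane R -> plane R) (z : C).
Proof.
apply: holomorphic_at_plane; apply: cdiffM; last exact: cdiff_cst.
exact: cdiff_id.
Qed.

Lemma disc_bundle_fiber x : biholomorphic (submersion_fiber U (proj L) x) (unit_disc R).
Proof.
have [V [t [s [triv Vx]]]] := trivialization_exists x.
have [e eE] := triv_frame_exists triv.
pose r := Num.sqrt (sqnorm h (e x)).
have r0 : 0 < r by rewrite sqrtr_gt0 sqnorm_gt0 // (triv_frame_neq0 triv eE).
(* the fibre over [x] is the disc of radius [eps / r] *)
pose k : R[i] := (r / eps)%:C%C.
have k0 : k != 0 by rewrite -rnorm_gt0 rnorm_real gtr0_norm divr_gt0.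
have nk : rnorm k = r / eps by rewrite rnorm_real gtr0_norm // divr_gt0.
pose f : tot L -> plane R := (fun w : plane R => (w : C) * k) \o (snd \o t).
pose g : plane R -> tot L := s \o (fun z : C => (x, z * k^-1) : prod_manifold X (plane R)).
exists f, g; split.
- apply: (@holomorphic_onW _ _ _ _ _ _ (proj L @^-1` V)).
  + exact: (triv_preimage_open triv).
  + by move=> v [_ /= ->].
  + move=> v Vv; apply: holomorphic_at_comp; last exact: holomorphic_at_scale.
    apply: holomorphic_at_comp; first exact: (triv_holomorphic triv).
    exact: holomorphic_at_snd.
- apply: (@holomorphic_onW _ _ _ _ _ _ setT); [exact: openT|by []|].
  move=> z _; apply: (@holomorphic_at_comp _ _ _ _ (plane R) (prod_manifold X (plane R)) (tot L)).
    apply: holomorphic_at_pair; first exact: holomorphic_at_cst.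
    exact: holomorphic_at_scale.
  exact: (triv_inv_holomorphic triv).
- move=> _ [v [Uv /= pv] <-]; rewrite /unit_disc /= /f /= rnormE (ltcR _ 1).
  have Vv : V (proj L v) by rewrite pv.
  move: Uv; rewrite /U /= (metric_norm_triv triv eE h Vv) pv -/r => Uv.
  by rewrite rnormM nk mulrA ltr_pdivrMr // mul1r.
- move=> _ [z z1 <-]; split; rewrite /= /g /=; last exact: (triv_inv_proj triv).
  move: z1; rewrite /unit_disc /= rnormE (ltcR _ 1) => z1.
  rewrite /U /= (metric_norm_triv_inv _ triv eE Vx) rnormM rnormV nk -/r.
  have -> : rnorm z * (r / eps)^-1 * r = rnorm z * eps by field; rewrite !gt_eqF.
  by rewrite gtr_pMl.
- split=> [v [Uv /= pv]|z _].
    rewrite /g /f /= mulfK // -pv -(triv_fst triv); last by rewrite pv.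
    by rewrite -surjective_pairing (trivK triv) // pv.
  by rewrite /g /f /= (triv_invK triv) //= mulfVK.
Qed.

End bundle.

Section second_derivative.
Variable R : realType.

(** If the second derivative at the minimum 0 were negative, the derivative would be
    negative on the right of 0. *)
Lemma second_derivative_min (a : R -> R) (d : R) : 0 < d ->
  (forall t, `|t| < d -> derivable a t 1) -> (forall t, `|t| < d -> a 0 <= a t) ->
  derivable (derive1 a) 0 1 -> 0 <= derive1 (derive1 a) 0.
Proof.
move=> d0 da amin da'; rewrite leNgt; apply/negP => neg.
have inI t : t \in `]- d, d[ -> `|t| < d by rewrite in_itv /= ltr_norml.
have I0 : 0 \in `](- d), d[ by rewrite in_itv /= oppr_lt0 d0.
have a'0 : derive1 a 0 = 0.
  have [] : is_derive (0 : R) 1 a 0; last by rewrite derive1E.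
  apply: (@derive1_at_min R a (- d) d 0 _ _ I0) => [|t /inI|t /inI];
    [lra|exact: da|exact: amin].
have lim : 'D_1 (derive1 a) 0 < 0 by rewrite -derive1E.
have : nbhs (0 : R) [set t | t != 0 ->
    t^-1 *: ((derive1 a \o shift 0) (t *: (1 : R)) - derive1 a 0) < 0].
  exact: (@cvgr_lt R _ _ _ _ _ da' 0 lim).
move=> /nbhs_ballP[r /= r0 hr].
have neg' t : 0 < t -> t < r -> derive1 a t < 0.
  move=> t0 tr; have tn0 : t != 0 by rewrite gt_eqF.
  have := hr t; rewrite -ball_normE /ball_ /= sub0r normrN gtr0_norm // => /(_ tr tn0).
  by rewrite a'0 subr0 addr0 /GRing.scale /= mulr1 pmulr_rlt0 ?invr_gt0.
pose c := Num.min r d / 2.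
have m0 : 0 < Num.min r d by rewrite lt_min r0.
have c0 : 0 < c by rewrite divr_gt0.
have cm : c < Num.min r d by rewrite /c; lra.
have [cr cd] : c < r /\ c < d by apply/andP; rewrite -lt_min.
have lt_d t : 0 <= t -> t <= c -> `|t| < d.
  by move=> t0 tc; rewrite ger0_norm //; exact: le_lt_trans cd.
have : a c < a 0.
  apply: (@ltr0_derive1_lt_cc R a 0 c).
  - by move=> t; rewrite in_itv /= => /andP[t0 tc]; apply: da; apply: lt_d; exact: ltW.
  - move=> t; rewrite in_itv /= => /andP[t0 tc]; apply: neg' => //; exact: lt_trans cr.
  - apply: derivable_within_continuous => t; rewrite in_itv /= => /andP[t0 tc].
    exact: da (lt_d _ t0 tc).
  - by rewrite in_itv /= lexx ltW.
  - by rewrite in_itv /= lexx ltW.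
  - exact: c0.
by rewrite ltNge amin // lt_d // ltW.
Qed.

End second_derivative.

Section hessian.
Variables (R : realType) (E : normedModType R[i]).
Implicit Types (u : E -> R) (v z : E).

Lemma real_derive_line u v z (x : R) :
  real_derive v u (z + x%:C%C *: v) = derive1 (fun t : R => u (z + t%:C%C *: v)) x.
Proof.
rewrite /real_derive /derive1.
suff -> : (fun h : R => h^-1 *: (u (z + x%:C%C *: v + (h + 0)%:C%C *: v) -
     u (z + x%:C%C *: v + 0%:C%C *: v))) =
  (fun h : R => h^-1 *: (u (z + (h + x)%:C%C *: v) - u (z + x%:C%C *: v))) by [].
apply/funext => k; rewrite addr0 scale0r addr0 -addrA -scalerDl -rmorphD /=.
by rewrite (addrC x).
Qed.

Lemma derivable_line u v z (x : R) :
  derivable (fun t : R => u (z + x%:C%C *: v + t%:C%C *: v)) 0 1 ->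
  derivable (fun t : R => u (z + t%:C%C *: v)) x 1.
Proof.
rewrite /derivable /=.
suff -> : (fun h : R => h^-1 *: (u (z + x%:C%C *: v + (h *: (1 : R) + 0)%:C%C *: v) -
     u (z + x%:C%C *: v + 0%:C%C *: v))) =
  (fun h : R => h^-1 *: (u (z + (h *: (1 : R) + x)%:C%C *: v) - u (z + x%:C%C *: v))) by [].
apply/funext => k; rewrite addr0 scale0r addr0 -addrA -scalerDl -rmorphD /=.
by rewrite (addrC x).
Qed.

(** Restrict [log u] to the real line through [z] in the direction [v]. *)
Lemma log_hessian_ge0 (O : set E) u v z : open O -> O z -> Ck_on 2 O u ->
  (forall y, O y -> 0 < u y) -> (forall y, O y -> u z <= u y) ->
  let l y := ln (u y) in
  derivable (fun t : R => real_derive v l (z + t%:C%C *: v)) 0 1 /\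
  0 <= real_derive v (real_derive v l) z.
Proof.
move=> oO Oz [_ uC] u0 umin l.
have [du [_ du2]] := uC v.
have [{}du2 _] := du2 v.
have [d d0 hd] : exists2 d : R, 0 < d & forall t : R, `|t| < d -> O (z + t%:C%C *: v).
  have /nbhs_rnormP[r r0 hr] := open_nbhs_nbhs (conj oO Oz).
  have v1 : 0 < rnorm v + 1 by rewrite ltr_wpDl ?rnorm_ge0.
  exists (r / (rnorm v + 1)); first by rewrite divr_gt0.
  move=> t; rewrite ltr_pdivlMr // => tr; apply: hr.
  rewrite addrC addKr rnormZ rnorm_real; apply: le_lt_trans tr.
  by rewrite ler_wpM2l // lerDl.
pose a (t : R) : R := l (z + t%:C%C *: v).
pose b (t : R) : R := u (z + t%:C%C *: v).
have db t : `|t| < d -> derivable b t 1 by move=> td; apply: derivable_line; exact: du (hd t td).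
have b0 t : `|t| < d -> 0 < b t by move=> td; exact: u0 (hd t td).
have da_is (t : R) : `|t| < d -> is_derive t (1 : R) a ((b t)^-1 * derive1 b t).
  move=> td; apply: (@realfun.is_derive1_comp R (@ln R) b); first exact: is_derive1_ln (b0 t td).
  by rewrite derive1E; exact: derivableP (db t td).
have a'E t : `|t| < d -> derive1 a t = (b t)^-1 * derive1 b t.
  by move=> td; have [_ <-] := da_is t td; rewrite derive1E.
have b'E t : derive1 b t = real_derive v u (z + t%:C%C *: v) by rewrite real_derive_line.
have a'E2 : derive1 a = (fun t : R => real_derive v l (z + t%:C%C *: v)).
  by apply/funext => t; rewrite real_derive_line.
have z0 : `|0 : R| < d by rewrite normr0.
have da' : derivable (derive1 a) 0 1.
  apply: (@near_eq_derivable _ _ _ ((fun t => (b t)^-1) * (derive1 b))).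
    apply/nbhs_ballP; exists d => //= t; rewrite -ball_normE /ball_ /= sub0r normrN => td.
    by rewrite a'E.
  apply: derivableM.
    by apply: derivableV; [rewrite gt_eqF // b0|exact: db].
  have -> : derive1 b = (fun t : R => real_derive v u (z + t%:C%C *: v)) by apply/funext.
  exact: du2 z Oz.
have e0 : z + 0%:C%C *: v = z by rewrite scale0r addr0.
split; first by rewrite -a'E2.
have -> : real_derive v (real_derive v l) z = derive1 (derive1 a) 0 by rewrite a'E2.
apply: (@second_derivative_min R a d d0 _ _ da') => t td; first by have [] := da_is t td.
rewrite /a /l e0 ler_ln ?posrE; [exact: umin (hd t td)|exact: u0|exact: u0 (hd t td)].
Qed.

End hessian.

(** * Curvature and comparison of metrics *)

Section curvature_at_minimum.
Variables (R : realType) (n : nat) (X : complexManifold 'rV[R[i]]_n).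
Variables (L : line_bundle X) (h : hermitian_metric L).

Lemma real_derive_half (v z : 'rV[R[i]]_n) (u : 'rV[R[i]]_n -> R) :
  derivable (fun t : R => u (z + t%:C%C *: v)) 0 1 ->
  real_derive v (fun y => u y / 2) z = real_derive v u z / 2.
Proof. by move=> du; rewrite /real_derive derive1Mr. Qed.

Lemma half_complex (a b : R) :
  (a%:C%C + 'i%C * b%:C%C) / 2 = Complex (a / 2) (b / 2).
Proof.
rewrite -(rmorph_nat (real_complex R)) -fmorphV.
by apply/eqP; rewrite eq_complex /=; apply/andP; split; apply/eqP; ring.
Qed.

Lemma Re_half (a b : R[i]) :
  complex.Re ((a - 'i%C * b) / 2) = (complex.Re a + complex.Im b) / 2.
Proof.
rewrite -(rmorph_nat (real_complex R)) -fmorphV.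
by case: a b => a a' [b b'] /=; ring.
Qed.

(** The real part of [dz j (dzbar j g)] for real [g] is a quarter of the sum of the
    second derivatives of [g] along [e_j] and [i e_j]. *)
Lemma curvature_at_minimum V s c x j : local_frame (L := L) V s -> V x ->
  atlas X c -> cdom c x ->
  (forall y, V y -> sqnorm h (s x) <= sqnorm h (s y)) ->
  complex.Re (curvature_mx h s c x j j) <= 0.
Proof.
move=> Vs Vx cX cx smin; have [oV _ s0] := Vs.
pose O := cmap c @` (cdom c `&` V).
pose u z : R := sqnorm h (s (cinv c z)).
pose l z : R := ln (u z).
have oO : open O by exact: chart_img_open.
have Oz : O (cmap c x) by exists x.
have uC : Ck_on 2 O u by exact: (hform_smooth h Vs cX 2).
have u0 z : O z -> 0 < u z.
  by move=> [y [cy Vy] <-]; rewrite /u cmapK // sqnorm_gt0 // s0.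
have umin z : O z -> u (cmap c x) <= u z.
  by move=> [y [cy Vy] <-]; rewrite /u !cmapK // smin.
have hess v := log_hessian_ge0 v oO Oz uC u0 umin.
have dcE v z : real_derivec v (fun z => (l z)%:C%C) z = (real_derive v l z)%:C%C.
  rewrite /real_derivec /= /real_complex_def; congr Complex.
  exact: (derive1_cst (0 : R) (0 : R)).
set e : 'rV[R[i]]_n := delta_mx 0 j.
have dzbarE : dzbar j (fun z => (l z)%:C%C) =
    fun z => Complex (real_derive e l z / 2) (real_derive ('i%C *: e) l z / 2).
  apply/funext => z; rewrite /dzbar !dcE -/e.
  exact: half_complex.
have ReN (a : R[i]) : complex.Re (- a) = - complex.Re a by case: a.
rewrite /curvature_mx mxE ReN oppr_le0.
rewrite -[dzbar j _]/(dzbar j (fun z => (l z)%:C%C)).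
rewrite dzbarE /dz -/e Re_half.
have [d1 h1] := hess e; have [d2 h2] := hess ('i%C *: e).
rewrite [complex.Re _](real_derive_half d1) [complex.Im _](real_derive_half d2).
exact: (divr_ge0 (addr_ge0 (divr_ge0 h1 (ler0n R 2)) (divr_ge0 h2 (ler0n R 2))) (ler0n R 2)).
Qed.

End curvature_at_minimum.

Section not_trivial.
Variables (R : realType) (n : nat) (X : complexManifold 'rV[R[i]]_n).
Variables (L : line_bundle X).
Local Notation C := (R[i])^o.

Lemma fiber_nonzero (x : X) : {u : fiber L x | u != 0}.
Proof.
apply: cid; have [V [t [s [triv Vx]]]] := trivialization_exists L x.
have [e eE] := triv_frame_exists triv.
by exists (e x); exact: (triv_frame_neq0 triv eE).
Qed.

Lemma fiber_proportional x (u w : fiber L x) : w != 0 -> exists a : R[i], u = a *: w.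
Proof.
move=> w0; have [V [t [s [triv Vx]]]] := trivialization_exists L x.
have [e eE] := triv_frame_exists triv.
have hu := triv_frame_coord triv eE u Vx; have hw := triv_frame_coord triv eE w Vx.
move: hu hw; set a : R[i] := (t _).2; set b : R[i] := (t _).2 => hu hw.
have b0 : b != 0 by apply: contra_neq w0 => b0; rewrite hw b0 scale0r.
by exists (a / b); rewrite hw scalerA divfK.
Qed.

(** The value does not depend on the vector chosen, since the fibres are lines; see
    [metric_ratioE]. *)
Definition metric_ratio (h0 h : hermitian_metric L) (x : X) : R :=
  sqnorm h0 (sval (fiber_nonzero x)) / sqnorm h (sval (fiber_nonzero x)).

Variables (h0 h : hermitian_metric L).

Lemma metric_ratioE x (u : fiber L x) : sqnorm h0 u = metric_ratio h0 h x * sqnorm h u.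
Proof.
rewrite /metric_ratio; case: (fiber_nonzero x) => w /= w0.
have [a ->] := fiber_proportional u w0.
have hw := sqnorm_gt0 h w0.
by rewrite !sqnormZ; field; rewrite gt_eqF.
Qed.

Lemma metric_ratio_gt0 x : 0 < metric_ratio h0 h x.
Proof. by rewrite /metric_ratio divr_gt0 // sqnorm_gt0 //; case: (fiber_nonzero x). Qed.

Lemma metric_ratio_continuous : continuous (metric_ratio h0 h).
Proof.
move=> x; have [V [t [s [triv Vx]]]] := trivialization_exists L x.
have [e eE] := triv_frame_exists triv.
have fe := triv_frame_local_frame triv eE.
have c0 := @sqnorm_frame_continuous _ _ _ _ h0 _ _ _ fe Vx.
have c1 := @sqnorm_frame_continuous _ _ _ _ h _ _ _ fe Vx.
have e_gt0 y : V y -> 0 < sqnorm h (e y).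
  by move=> Vy; apply: sqnorm_gt0; exact: (triv_frame_neq0 triv eE).
have rE y : V y -> metric_ratio h0 h y = sqnorm h0 (e y) / sqnorm h (e y).
  by move=> Vy; rewrite (metric_ratioE (e y)) mulfK // gt_eqF // e_gt0.
have c2 := continuousM c0 (@continuousV _ _ _ _ (lt0r_neq0 (e_gt0 _ Vx)) c1).
move=> P; rewrite (rE _ Vx) => /c2.
have xV := open_nbhs_nbhs (conj (triv_open triv) Vx).
by apply: filterS2 xV => y Vy /=; rewrite rE.
Qed.

Lemma metric_ratio_min : [set: X] !=set0 -> compact [set: X] ->
  exists x, forall y, metric_ratio h0 h x <= metric_ratio h0 h y.
Proof.
move=> X0 Xc.
have [|x _ hx] := compact_EVT_min X0 Xc (f := metric_ratio h0 h).
  by apply: continuous_subspaceT; exact: metric_ratio_continuous.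
by exists x => y; apply: hx; rewrite inE.
Qed.

End not_trivial.

(** * The disc bundle of a positive line bundle is not locally trivial *)

Section fiber_derivative.
Variables (R : realType) (n : nat) (X : complexManifold 'rV[R[i]]_n).
Local Notation C := (R[i])^o.

Definition vertical_derivative (f : X * C -> C) (x : X) : R[i] :=
  'd (fun w : C => f (x, w)) (0 : C) (1 : C).

(** In charts this is a directional derivative of a function of [n + 1] variables, to
    which [near_derive_differentiable] applies. *)
Lemma vertical_derivative_holomorphic (f : X * C -> C) (x : X) :
  (\forall b \near ((x, 0) : prod_manifold X (plane R)),
     holomorphic_at (f : prod_manifold X (plane R) -> plane R) b) ->
  holomorphic_at (vertical_derivative f : X -> plane R) x.
Proof.
move=> hf; apply: holomorphic_at_to_plane => c cX cx.
pose pc := prodchart c (idchart R).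
pose Phi (q : 'rV[R[i]]_n * C) : C := f (cinv c q.1, q.2).
have pcX : atlas (prod_manifold X (plane R)) pc by exists (c, idchart R).
have dPhi : \forall q \near (cmap c x, 0 : C), differentiable Phi q.
  have := @holomorphic_chart_near R _ _ (prod_manifold X (plane R)) (plane R)
    f (x, 0) pc (idchart R) hf pcX erefl.
  by apply; split.
have dv := near_derive_differentiable (0 : 'rV[R[i]]_n, 1 : C) dPhi.
pose j (z : 'rV[R[i]]_n) : 'rV[R[i]]_n * C := (z, 0).
have dj : differentiable j (cmap c x).
  apply: differentiable_pair; last exact: differentiable_cst.
  by have [] := is_diff_id (cmap c x).
apply: (near_differentiable _ (differentiable_comp dj dv)).1.
have : \forall z \near cmap c x, differentiable Phi (z, 0 : C).
  exact: (differentiable_continuous dj) _ dPhi.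
apply: filterS => z dz /=; rewrite /vertical_derivative.
pose i (w : C) : 'rV[R[i]]_n * C := (z, w).
have di : differentiable i (0 : C).
  apply: differentiable_pair; first exact: differentiable_cst.
  by have [] := is_diff_id (0 : C).
have e1 := congr1 (fun h : C -> C => h 1) (diff_comp di dz).
have e2 : 'd i (0 : C) 1 = (0, 1).
  have id_diff : differentiable (@id C) (0 : C) by have [] := is_diff_id (0 : C).
  have := congr1 (fun h : C -> 'rV[R[i]]_n * C => h 1)
    (diff_pair (differentiable_cst z (0 : C)) id_diff).
  move=> e; apply: etrans e _; rewrite diff_cst; congr pair.
  by rewrite diff_val.
apply: esym; apply: etrans e1 _.
exact: (congr1 (fun q => 'd Phi (z, 0 : C) q) e2).
Qed.

End fiber_derivative.

Section retraction.
Variables (R : realType) (n : nat) (X : complexManifold 'rV[R[i]]_n).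
Variables (L : line_bundle X) (h : hermitian_metric L) (eps : R).
Hypothesis eps0 : 0 < eps.
Local Notation C := (R[i])^o.
Let U : set (tot L) := [set v | metric_norm h v < eps].

(** In a trivialization over a neighbourhood of [x0], replace the base point by
    [x0]. *)
Lemma local_retraction x0 : holomorphically_locally_trivial U (proj L) ->
  exists (V : set X) (rho : tot L -> tot L),
    [/\ open V, V x0,
        forall v, U v -> V (proj L v) -> holomorphic_at rho v,
        forall v, U v -> V (proj L v) -> U (rho v) /\ proj L (rho v) = x0
      & forall v, U v -> proj L v = x0 -> rho v = v].
Proof.
move=> [k [F [_ lt]]].
have [V [phi [psi [oV Vx0 [hphi hpsi phiB psiA [psiK phiK]] phi2]]]] := lt x0.
pose A := U `&` proj L @^-1` V.
have proj_hol v : holomorphic_at (proj L) v.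
  have [V' [t [s [triv Vx]]]] := trivialization_exists L (proj L v).
  exact: (proj_holomorphic_at triv Vx).
have oU : open U by exact: disc_bundle_open.
have oA : open A.
  apply: openI => //; apply: open_comp => // v _; by case: (proj_hol v).
have oFV : open ([set: F] `*` V) by apply: open_setX => //; exact: openT.
pose fix0 (b : prod_manifold F X) : prod_manifold F X := (b.1, x0).
exists V, (psi \o (fix0 \o phi)); split=> //.
- move=> v Uv Vv; apply: holomorphic_at_comp.
    apply: holomorphic_at_comp; first exact: (holomorphic_on_open oA hphi).
    by apply: holomorphic_at_pair; [exact: holomorphic_at_fst|exact: holomorphic_at_cst].
  apply: (@holomorphic_on_open _ _ _ (prod_manifold F X) (tot L) _ psi oFV hpsi).
  by split.
- move=> v Uv Vv; set b := fix0 (phi v).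
  have Bb : ([set: F] `*` V) b by split.
  have [Ub Vb] : A (psi b) by apply: psiA; exists b.
  by split=> //=; rewrite -/b -(phi2 _ Ub Vb) (phiK _ Bb).
- move=> v Uv vx0; have Vv : V (proj L v) by rewrite vx0.
  rewrite /= /fix0 -vx0 -(phi2 _ Uv Vv) -surjective_pairing.
  by apply: psiK; split.
Qed.

(** The frame [sg] divides by the vertical derivative [G] of the retraction.  The
    Cauchy estimate for [G] and the choice of [x0] make its [h0]-norm minimal at
    [x0]. *)
Lemma disc_bundle_not_trivial : (0 < n)%N -> [set: X] !=set0 -> compact [set: X] ->
  positive_line_bundle L -> ~ holomorphically_locally_trivial U (proj L).
Proof.
move=> n0 X0 Xc [h0 pos] lt.
have [x0 xmin] := metric_ratio_min h0 h X0 Xc.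
have [V1 [rho [oV1 V1x0 hrho rhoU rhoK]]] := local_retraction x0 lt.
have [V2 [t [s [triv V2x0]]]] := trivialization_exists L x0.
have [e eE] := triv_frame_exists triv.
pose W0 := V1 `&` V2.
have oW0 : open W0 by apply: openI => //; exact: triv_open triv.
pose rad x := Num.sqrt (sqnorm h (e x)).
have sq_rad x : rad x ^+ 2 = sqnorm h (e x) by rewrite sqr_sqrtr // sqnorm_ge0.
have rad_gt0 x : V2 x -> 0 < rad x.
  by move=> V2x; rewrite sqrtr_gt0 sqnorm_gt0 // (triv_frame_neq0 triv eE).
have normE x (w : R[i]) : V2 x -> metric_norm h (s (x, w)) = rnorm w * rad x.
  by move=> V2x; exact: (metric_norm_triv_inv h w triv eE).
(* the retraction onto the fibre over [x0], in the trivialization of [L] *)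
pose f (b : X * C) : C := (t (rho (s b))).2.
have hs b : V2 b.1 -> holomorphic_at s b by exact: (triv_inv_holomorphic triv).
have oU : open U by exact: disc_bundle_open.
have hf b : W0 b.1 -> U (s b) ->
    holomorphic_at (f : prod_manifold X (plane R) -> plane R) b.
  case: b => x w [/= V1x V2x] Ub.
  have pb : proj L (s (x, w)) = x by exact: (triv_inv_proj triv).
  have V1b : V1 (proj L (s (x, w))) by rewrite pb.
  have [Ur pr] := rhoU _ Ub V1b.
  apply: (@holomorphic_at_comp _ _ _ _ (prod_manifold X (plane R)) (tot L) (plane R)
    s (snd \o (t \o rho))); first exact: hs.
  apply: holomorphic_at_comp; last exact: holomorphic_at_snd.
  apply: holomorphic_at_comp; first exact: hrho.
  by apply: (triv_holomorphic triv); rewrite pr.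
have f_bound b : W0 b.1 -> U (s b) -> rnorm (f b) < eps / rad x0.
  case: b => x w [/= V1x V2x] Ub.
  have pb : proj L (s (x, w)) = x by exact: (triv_inv_proj triv).
  have V1b : V1 (proj L (s (x, w))) by rewrite pb.
  have [Ur pr] := rhoU _ Ub V1b.
  have V2r : V2 (proj L (rho (s (x, w)))) by rewrite pr.
  move: Ur; rewrite /U /= (metric_norm_triv triv eE h V2r) pr -/(rad x0) => Ur.
  by rewrite ltr_pdivlMr // rad_gt0.
have f_id w : rnorm w < eps / rad x0 -> f (x0, w) = w.
  rewrite ltr_pdivlMr ?rad_gt0 // => hw.
  have Uw : U (s (x0, w)) by rewrite /U /= normE.
  by rewrite /f rhoK // ?(triv_inv_proj triv) // (triv_invK triv).
pose G := vertical_derivative f.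
have U_disc x (w : R[i]) : V2 x -> rnorm w < eps / rad x -> U (s (x, w)).
  by move=> V2x hw; rewrite /U /= normE // -ltr_pdivlMr // rad_gt0.
have G_bound x : W0 x -> rnorm (G x) <= rad x / rad x0.
  move=> [V1x V2x].
  have rx := rad_gt0 _ V2x; have rx0 := rad_gt0 _ V2x0.
  have r0 : 0 < eps / rad x by rewrite divr_gt0.
  have -> : rad x / rad x0 = eps / rad x0 * rnorm (1 : C) / (eps / rad x).
    by rewrite rnorm1; field; rewrite !gt_eqF.
  apply: (@cauchy_estimate R C (fun w => f (x, w))) => // w; rewrite subr0 => hw.
    have hfw : holomorphic_at (f : prod_manifold X (plane R) -> plane R) (x, w).
      by apply: hf; [split|exact: U_disc].
    have := @holomorphic_at_comp _ _ _ _ (plane R) (prod_manifold X (plane R)) (plane R)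
      (fun w => (x, w)) f w (holomorphic_at_pair (holomorphic_at_cst _ _) (holomorphic_at_id
          _)) hfw.
    by move=> /holomorphic_at_from_plane/(_ erefl I).
  by apply: ltW; apply: f_bound; [split|exact: U_disc].
have G_x0 : G x0 = 1.
  have r0 : 0 < eps / rad x0 by rewrite divr_gt0 // rad_gt0.
  have nid : \forall w \near (0 : C), id w = f (x0, w).
    apply/nbhs_rnormP; exists (eps / rad x0) => // w; rewrite subr0 => hw.
    by rewrite f_id.
  have id_diff : differentiable (@id C) (0 : C) by have [] := is_diff_id (0 : C).
  have [_ dE] := near_differentiable nid id_diff.
  have := congr1 (fun h : C -> C => h 1) dE => dE1; apply: etrans dE1 _.
  by rewrite diff_val.
have hG x : W0 x -> holomorphic_at (G : X -> plane R) x.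
  move=> W0x; apply: vertical_derivative_holomorphic.
  have cs : {for (x, 0), continuous s} by case: (hs (x, 0) W0x.2).
  have U0 : U (s (x, 0)).
    by apply: U_disc; [exact: W0x.2|rewrite rnorm0 divr_gt0 // rad_gt0 //; exact: W0x.2].
  have tF : Filter (nbhs ((x, 0) : prod_manifold X (plane R))).
    exact: (@nbhs_filter (prod_manifold X (plane R))).
  have n1 : \forall b \near ((x, 0) : prod_manifold X (plane R)), U (s b).
    exact: cs _ (open_nbhs_nbhs (conj oU U0)).
  have c1 : {for ((x, 0) : prod_manifold X (plane R)), continuous (fst : _ -> X)}.
    by case: (holomorphic_at_fst ((x, 0) : prod_manifold X (plane R))).
  have n2 : \forall b \near ((x, 0) : prod_manifold X (plane R)), W0 b.1.
    exact: c1 _ (open_nbhs_nbhs (conj oW0 W0x)).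
  by apply: filterS2 n1 n2 => b Ub Wb; exact: hf.
pose W := [set x | W0 x /\ G x != 0].
have oW : open W.
  rewrite openE => x [W0x Gx].
  have [cG _] := hG x W0x.
  have nG : \forall w \near (G x : C), w != 0.
    apply/nbhs_rnormP; exists (rnorm (G x)); first by rewrite rnorm_gt0.
    by move=> w; apply: contraTneq => ->; rewrite sub0r rnormN ltxx.
  suff : \forall y \near x, W0 y /\ G y != 0 by [].
  have n1 : \forall y \near x, G y != 0 by exact: cG _ nG.
  by apply: filterI => //; exact: (open_nbhs_nbhs (conj oW0 W0x)).
have hGV x : W x -> holomorphic_at ((fun y => (G y)^-1) : X -> plane R) x.
  move=> [W0x Gx].
  apply: (@holomorphic_at_comp _ _ _ _ X (plane R) (plane R) G (fun z => z^-1)); first exact: hG.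
  apply: holomorphic_at_plane; apply: (@cdiffV R id) => //; exact: cdiff_id.
pose sg x := (G x)^-1 *: e x.
have fr : local_frame (L := L) W sg.
  apply: (triv_local_frame triv eE) => //; first by move=> x [[]].
  by move=> x [_ Gx]; rewrite invr_eq0.
have Wx0 : W x0 by split; [split|rewrite G_x0 oner_neq0].
have sg_min y : W y -> sqnorm h0 (sg x0) <= sqnorm h0 (sg y).
  move=> [W0y Gy]; rewrite !(metric_ratioE h0 h) /sg !sqnormZ G_x0 invr1 rnorm1.
  rewrite expr1n mul1r -!sq_rad rnormV.
  have rx0 := rad_gt0 _ V2x0; have ry := rad_gt0 _ W0y.2.
  apply: ler_pM; rewrite ?(ltW (metric_ratio_gt0 _ _ _)) ?sqr_ge0 //.
  rewrite -exprMn lerXn2r ?nnegrE ?(ltW rx0) //.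
    by apply: mulr_ge0; [rewrite invr_ge0 rnorm_ge0|exact: ltW].
  have Gy0 : 0 < rnorm (G y) by rewrite rnorm_gt0.
  rewrite mulrC ler_pdivlMr // mulrC -ler_pdivlMr //; exact: G_bound.
have [c cX cx] := atlas_cover x0.
pose j0 : 'I_n := Ordinal n0.
have := curvature_at_minimum j0 fr Wx0 cX cx sg_min.
have w0 : (delta_mx 0 j0 : 'rV[R[i]]_n) != 0.
  by apply/eqP => /matrixP/(_ 0 j0); rewrite !mxE !eqxx => /eqP; rewrite oner_eq0.
(* in the direction [e_j0], positivity concerns one diagonal entry *)
have := pos W sg c x0 fr Wx0 cX cx _ w0.
rewrite (bigD1 j0) //= (bigD1 j0) //= big1; last first.
  by move=> k kj; rewrite !mxE eqxx (negbTE kj) /= conjC0 mulr0.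
rewrite big1; last first.
  move=> k kj; rewrite big1 // => k' _.
  by rewrite [X in _ * X * _]mxE eqxx (negbTE kj) /= mulr0 mul0r.
rewrite !addr0 [X in _ * X * _]mxE [X in _ * X^*]mxE !eqxx /= conjC1 !mulr1.
by rewrite ltcE /= => /andP[_ lt0]; rewrite leNgt lt0.
Qed.

End retraction.

Theorem proposition2p2 (R : realType) (n : nat) (X : complexManifold 'rV[R[i]]_n)
    (L : line_bundle X) (h : hermitian_metric L) (eps : R) :
  (0 < n)%N -> [set: X] !=set0 -> compact [set: X] ->
  positive_line_bundle L -> 0 < eps ->
  let U : set (tot L) := [set v | metric_norm h v < eps] in
  let p : tot L -> X := proj L in
  [/\ holomorphic_submersion U p /\ p @` U = [set: X],
      forall x, biholomorphic (submersion_fiber U p x) (unit_disc R)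
    & ~ holomorphically_locally_trivial U p].
Proof.
move=> n0 X0 Xc pos eps0 U p; split.
- split; first exact: disc_bundle_submersion.
  exact: disc_bundle_surjective.
- by move=> x; exact: disc_bundle_fiber.
- exact: disc_bundle_not_trivial.
Qed.
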